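(* Let $F$ be a skew-field with infinite centre $K$, let $m,n\ge 1$, and let $G_1\le \mathrm{Gl}_nF$ and $G_2\le \mathrm{Gl}_mF$ be subgroups such that at least one of them contains the group of $K^\star$-multiples of the identity matrix. Let $M\subseteq M_{n,m}(F)$ be a $K$-vector subspace such that $G_1M=M=MG_2$. Then the natural embedding $$i:\begin{pmatrix} G_1&0\\0&G_2\end{pmatrix}\hookrightarrow \begin{pmatrix} G_1&M\\0&G_2\end{pmatrix}$$ induces an isomorphism on the corresponding integral homology groups, in every degree.
   Context: A skew-field is a (not necessarily commutative) division ring. $M_{n,m}(F)$ is the set of $n\times m$ matrices over $F$. $\begin{pmatrix} G_1&M\\0&G_2\end{pmatrix}$ denotes the subgroup of $\mathrm{Gl}_{n+m}F$ of all block matrices $\begin{pmatrix} g_1&x\\0&g_2\end{pmatrix}$ with $g_1\in G_1$, $g_2\in G_2$, $x\in M$, and $\begin{pmatrix} G_1&0\\0&G_2\end{pmatrix}$ is its subgroup with $x=0$. Homology is group homology with trivial coefficients $\mathbb Z$. $K^\star=K\setminus\{0\}$. *)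

(* Defs.v *)
From HB Require Import structures.
From mathcomp Require Import all_boot all_algebra zify.
From mathcomp Require Import boolp classical_sets cardinality.
From mathcomp Require Import generic_quotient ring_quotient.
From mathcomp.multinomials Require Import freeg.

Set Implicit Arguments.
Unset Strict Implicit.
Unset Printing Implicit Defensive.

Import GRing.Theory.

Local Open Scope ring_scope.
Local Open Scope classical_set_scope.
Local Open Scope quotient_scope.

Section Subgroup.
Variables (G : groupType) (S : groupClosed G).

Definition subgroup := {x : G | x \in S}.

Lemma groupClosedP : group_closed S.
Proof. by split; [exact: gpred1 | exact: gpredF]. Qed.

HB.instance Definition _ := SubChoice.on subgroup.
HB.instance Definition _ :=
  SubChoice_isSubGroup.Build G (mem S) subgroup groupClosedP.

End Subgroup.

Section SubgroupInclusion.
Variables (G : groupType) (S T : groupClosed G) (sST : {subset S <= T}).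

Definition subgroup_incl (x : subgroup S) : subgroup T :=
  exist _ (val x) (sST (valP x)).

Fact subgroup_incl_is_mul : {morph subgroup_incl : x y / (x * y)%g}.
Proof. by move=> x y; apply: val_inj. Qed.

HB.instance Definition _ :=
  isMultiplicative.Build (subgroup S) (subgroup T) subgroup_incl
    subgroup_incl_is_mul.

End SubgroupInclusion.

Section FgliftAdditive.
Variables (R : nzRingType) (K : choiceType) (M : lmodType R) (f : K -> M).
HB.instance Definition _ :=
  GRing.isZmodMorphism.Build {freeg K / R} M (fglift f) (lift_is_additive f).
End FgliftAdditive.

(* H_q(G; Z) is the homology of the inhomogeneous bar complex: C_q is the free
   abelian group on q-tuples [g_0|...|g_(q-1)], and
     d [g_0|...|g_q] = [g_1|...|g_q]
       + \sum_(0 < i <= q) (-1)^i [g_0|...|g_(i-1) g_i|...|g_q]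
       + (-1)^(q+1) [g_0|...|g_(q-1)]. *)
Section GroupHomology.
Variable G : groupType.

Definition chain (q : nat) := {freeg {ffun 'I_q -> G} / int}.

HB.instance Definition _ q := GRing.Lmodule.on (chain q).

Definition face q (i : 'I_q.+2) (g : {ffun 'I_q.+1 -> G}) : {ffun 'I_q -> G} :=
  [ffun j : 'I_q =>
    let gj := g (widen_ord (leqnSn q) j) in
    let gj1 := g (fintype.lift ord0 j) in
    if (j.+1 < i)%N then gj else if j.+1 == i then (gj * gj1)%g else gj1].

Definition bar_boundary q (g : {ffun 'I_q.+1 -> G}) : chain q :=
  \sum_(i < q.+2) << (-1) ^+ i *g face i g >>.

Definition differential q : chain q -> chain q.-1 :=
  match q with
  | 0 => fun=> 0
  | q'.+1 => fglift (@bar_boundary q')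
  end.

Arguments differential : simpl never.

Fact differential_is_zmod_morphism q : zmod_morphism (@differential q).
Proof.
case: q => [|q] x y; first by rewrite /differential subr0.
exact: lift_is_additive.
Qed.

HB.instance Definition _ q :=
  GRing.isZmodMorphism.Build (chain q) (chain q.-1) (@differential q)
    (@differential_is_zmod_morphism q).

Lemma face_face q (i : 'I_q.+3) (j : 'I_q.+2) (i' : 'I_q.+2) (j' : 'I_q.+3)
    (g : {ffun 'I_q.+2 -> G}) :
  (j < i)%N -> i = i'.+1 :> nat -> j = j' :> nat ->
  face j (face i g) = face i' (face j' g).
Proof.
move=> ltji ei ej; apply/ffunP=> k; rewrite !ffunE /=.
have -> : fintype.lift ord0 (widen_ord (leqnSn q) k) =
          widen_ord (leqnSn q.+1) (fintype.lift ord0 k) by apply: val_inj.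
rewrite !/bump /= !add1n ei -ej.
move: ltji; rewrite ei ltnS => leji.
by do ![case: ltngtP => //= ?]; rewrite ?mulgA //; lia.
Qed.

Lemma differentialK q (c : chain q.+1) : differential (differential c) = 0.
Proof.
case: q c => [//|q] c.
rewrite -[c]freeg_sumE !raddf_sum; apply: big1 => g _ /=.
rewrite {2}/differential liftU -[coeff g c]intz scaler_int raddfMz /=.
suff -> : differential (bar_boundary g) = 0 by rewrite mul0rz.
rewrite /bar_boundary raddf_sum /=.
pose E (p : 'I_q.+3 * 'I_q.+2) : chain q :=
  << (-1) ^+ p.1 * (-1) ^+ p.2 *g face p.2 (face p.1 g) >>.
have fgZ (a b : int) (k : {ffun 'I_q -> G}) :
  a *: << b *g k >> = << a * b *g k >> :> chain q.
  by rewrite -[X in X *: _]intz scaler_int freeg_mulz -mulrzl intz.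
transitivity (\sum_p E p).
  rewrite -(pair_bigA _ (fun i j => E (i, j))) /=; apply: eq_bigr => i _.
  rewrite /differential liftU scaler_sumr; apply: eq_bigr => j _.
  exact: fgZ.
pose up (p : 'I_q.+3 * 'I_q.+2) : 'I_q.+3 * 'I_q.+2 :=
  (fintype.lift ord0 p.2, inord p.1).
pose dn (p : 'I_q.+3 * 'I_q.+2) : 'I_q.+3 * 'I_q.+2 :=
  (widen_ord (leqnSn _) p.2, inord p.1.-1).
rewrite (bigID (fun p : 'I_q.+3 * 'I_q.+2 => p.2 < p.1)%N) /=.
rewrite (reindex_onto up dn) /=; last first.
  move=> [i j] /= ltji; congr (_, _); apply: val_inj => /=.
    by rewrite /bump inordK; have := ltn_ord i; lia.
  by rewrite inordK.
rewrite (eq_big (fun p : 'I_q.+3 * 'I_q.+2 => ~~ (p.2 < p.1)%N)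
          (fun p => - E p)); first by rewrite sumrN addNr.
  move=> [i j] /=; rewrite /bump /= add1n.
  have [leij|ltji] := leqP i j.
    have ei : (inord i : 'I_q.+2) = i :> nat.
      by rewrite inordK //; have := ltn_ord j; lia.
    rewrite ei ltnS leij /=; apply/eqP; congr (_, _); apply: val_inj => //=.
    by rewrite add0n inordK.
  apply/negbTE/negP => /andP[+ /eqP[]] => + /(congr1 val) /= e _.
  by rewrite e; lia.
move=> [i j] /=; rewrite /bump /= add1n => /andP[+ /eqP[]].
move=> + /(congr1 val) /= ei _; rewrite ei => ltij.
rewrite /E /= /bump /= add1n (face_face (i' := j) (j' := i)) ?ei //.
by rewrite freegUN exprS mulN1r mulNr mulrC.
Qed.

Definition is_cycle q : {pred chain q} := fun c => differential c == 0.

Fact is_cycle_closed q : zmod_closed (@is_cycle q).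
Proof.
split=> [|x y]; first by apply/eqP; exact: raddf0.
by move=> /eqP x0 /eqP y0; apply/eqP; rewrite raddfB /= x0 y0 subr0.
Qed.

HB.instance Definition _ q :=
  GRing.isZmodClosed.Build (chain q) (@is_cycle q) (@is_cycle_closed q).

Definition cycle_group q := {c : chain q | c \in @is_cycle q}.

HB.instance Definition _ q := SubChoice.on (cycle_group q).
HB.instance Definition _ q :=
  [SubChoice_isSubZmodule of cycle_group q by <:].

Definition is_boundary q : {pred cycle_group q} :=
  fun z => `[< exists c : chain q.+1, differential c = val z >].

Fact is_boundary_closed q : zmod_closed (@is_boundary q).
Proof.
split=> [|x y]; first by apply/asboolP; exists 0; rewrite !raddf0.
move=> /asboolP[c cx] /asboolP[d dy]; apply/asboolP; exists (c - d).
by rewrite raddfB /= cx dy.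
Qed.

HB.instance Definition _ q :=
  GRing.isZmodClosed.Build (cycle_group q) (@is_boundary q)
    (@is_boundary_closed q).

Definition homology q := Quotient.quot (@is_boundary q : zmodClosed _).

HB.instance Definition _ q := GRing.Zmodule.on (homology q).

End GroupHomology.

Section InducedMap.
Variables (G H : groupType) (f : {multiplicative G -> H}).

Definition chain_map q : chain G q -> chain H q :=
  fglift (fun g : {ffun 'I_q -> G} => << [ffun j => f (g j)] >> : chain H q).

HB.instance Definition _ q :=
  GRing.isZmodMorphism.Build (chain G q) (chain H q) (@chain_map q)
    (lift_is_additive _).

Lemma face_map q (i : 'I_q.+2) (g : {ffun 'I_q.+1 -> G}) :
  face i [ffun j => f (g j)] = [ffun j => f (face i g j)].
Proof.
by apply/ffunP=> j; rewrite !ffunE /=; do 2?case: ifP => _; rewrite ?gmulfM.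
Qed.

Lemma differential_chain_map q (c : chain G q) :
  differential (chain_map c) = chain_map (differential c).
Proof.
case: q c => [|q] c; first by rewrite [RHS]raddf0.
rewrite -[c]freeg_sumE !raddf_sum; apply: eq_bigr => g _ /=.
rewrite [chain_map _]liftU /differential !liftU -[coeff g c]intz !scaler_int.
rewrite !raddfMz /=; congr (_ *~ _); rewrite liftU scale1r /bar_boundary raddf_sum.
apply: eq_bigr => i _ /=; rewrite /chain_map liftU face_map.
by rewrite -[X in X *: _]intz scaler_int freegU_mulz intz.
Qed.

Fact cycle_map_subproof q (z : cycle_group G q) :
  chain_map (val z) \in @is_cycle H q.
Proof.
by apply/eqP; rewrite differential_chain_map (eqP (valP z)) raddf0.
Qed.

Definition cycle_map q (z : cycle_group G q) : cycle_group H q :=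
  exist _ (chain_map (val z)) (cycle_map_subproof z).

Fact cycle_map_is_zmod_morphism q : zmod_morphism (@cycle_map q).
Proof. by move=> x y; apply: val_inj; rewrite /= raddfB. Qed.

HB.instance Definition _ q :=
  GRing.isZmodMorphism.Build (cycle_group G q) (cycle_group H q) (@cycle_map q)
    (@cycle_map_is_zmod_morphism q).

Definition homology_map q (x : homology G q) : homology H q :=
  \pi_(homology H q) (cycle_map (repr x)).

Lemma homology_map_pi q (z : cycle_group G q) :
  homology_map (\pi_(homology G q) z) = \pi_(homology H q) (cycle_map z).
Proof.
rewrite /homology_map; apply/eqP; rewrite -Quotient.idealrBE -raddfB.
have: repr (\pi_(homology G q) z) - z \in @is_boundary G q.
  by rewrite Quotient.idealrBE reprK.
move=> /asboolP[c dc]; apply/asboolP; exists (chain_map c).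
by rewrite differential_chain_map dc.
Qed.

Fact homology_map_is_zmod_morphism q : zmod_morphism (@homology_map q).
Proof.
by elim/quotW=> x; elim/quotW=> y; rewrite -raddfB !homology_map_pi !raddfB.
Qed.

HB.instance Definition _ q :=
  GRing.isZmodMorphism.Build (homology G q) (homology H q) (@homology_map q)
    (@homology_map_is_zmod_morphism q).

End InducedMap.

Section GeneralLinear.
Variables (F : nzRingType) (n : nat).

Definition invertible_mx : {pred 'M[F]_n} :=
  fun A => `[< exists B : 'M[F]_n, A *m B = 1%:M /\ B *m A = 1%:M >].

Definition GL := {A : 'M[F]_n | A \in invertible_mx}.

HB.instance Definition _ := SubChoice.on GL.

Lemma GL_ex_inv (g : GL) :
  exists B : 'M[F]_n, val g *m B = 1%:M /\ B *m val g = 1%:M.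
Proof. exact: asboolW (valP g). Qed.

Definition GL_invmx (g : GL) : 'M[F]_n := projT1 (cid (GL_ex_inv g)).

Lemma GL_mulmxV (g : GL) : val g *m GL_invmx g = 1%:M.
Proof. by case: (projT2 (cid (GL_ex_inv g))). Qed.

Lemma GL_mulVmx (g : GL) : GL_invmx g *m val g = 1%:M.
Proof. by case: (projT2 (cid (GL_ex_inv g))). Qed.

Fact GL_one_subproof : (1%:M : 'M[F]_n) \in invertible_mx.
Proof. by apply/asboolP; exists 1%:M; rewrite mulmx1. Qed.

Fact GL_mul_subproof (g h : GL) : val g *m val h \in invertible_mx.
Proof.
apply/asboolP; exists (GL_invmx h *m GL_invmx g); split.
  by rewrite mulmxA -(mulmxA (val g)) GL_mulmxV mulmx1 GL_mulmxV.
by rewrite mulmxA -(mulmxA (GL_invmx h)) GL_mulVmx mulmx1 GL_mulVmx.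
Qed.

Fact GL_inv_subproof (g : GL) : GL_invmx g \in invertible_mx.
Proof. by apply/asboolP; exists (val g); rewrite GL_mulVmx GL_mulmxV. Qed.

Definition GL_one : GL := exist _ 1%:M GL_one_subproof.
Definition GL_mul (g h : GL) : GL :=
  exist _ (val g *m val h) (GL_mul_subproof g h).
Definition GL_inv (g : GL) : GL := exist _ (GL_invmx g) (GL_inv_subproof g).

Fact GL_mulA : associative GL_mul.
Proof. by move=> g h k; apply: val_inj; rewrite /= mulmxA. Qed.
Fact GL_mul1 : left_id GL_one GL_mul.
Proof. by move=> g; apply: val_inj; rewrite /= mul1mx. Qed.
Fact GL_1mul : right_id GL_one GL_mul.
Proof. by move=> g; apply: val_inj; rewrite /= mulmx1. Qed.
Fact GL_mulV : left_inverse GL_one GL_inv GL_mul.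
Proof. by move=> g; apply: val_inj; exact: GL_mulVmx. Qed.
Fact GL_Vmul : right_inverse GL_one GL_inv GL_mul.
Proof. by move=> g; apply: val_inj; exact: GL_mulmxV. Qed.

HB.instance Definition _ :=
  isGroup.Build GL GL_mulA GL_mul1 GL_1mul GL_mulV GL_Vmul.

End GeneralLinear.

Definition centre (F : nzRingType) : set F :=
  [set a | forall b, GRing.comm a b].
Arguments centre F : clear implicits.

Definition central_scalars (F : nzRingType) n : set (GL F n) :=
  [set g | exists2 a, centre F a /\ a != 0 & val g = a%:M].
Arguments central_scalars F n : clear implicits.

(* For central a, left scaling a *: x is also right scaling by a. *)
Definition centre_subspace (F : nzRingType) n m (M : set 'M[F]_(n, m)) :=
  [/\ M 0, forall x y, M x -> M y -> M (x + y)
    & forall a x, centre F a -> M x -> M (a *: x)].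

Section Block.
Variables (F : nzRingType) (n m : nat).
Variables (G1 : groupClosed (GL F n)) (G2 : groupClosed (GL F m)).

Definition mulGM (M : set 'M[F]_(n, m)) : set 'M[F]_(n, m) :=
  [set val g *m x | g in [set` G1] & x in M].

Definition mulMG (M : set 'M[F]_(n, m)) : set 'M[F]_(n, m) :=
  [set x *m val g | x in M & g in [set` G2]].

Definition block_pred (M : set 'M[F]_(n, m)) : {pred GL F (n + m)} :=
  fun g => `[< exists g1 g2 x,
    [/\ g1 \in G1, g2 \in G2, M x & val g = block_mx (val g1) x 0 (val g2)] >].

Section BlockGroup.
Variable M : set 'M[F]_(n, m).
Hypotheses (subspM : centre_subspace M).
Hypotheses (G1M : mulGM M = M) (MG2 : mulMG M = M).

Fact block_pred_closed : group_closed (block_pred M).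
Proof.
case: subspM => M0 MD MZ.
have MN x : M x -> M (- x).
  by move=> Mx; rewrite -scaleN1r; apply: MZ => // b; exact/commr_sym/commrN1.
have GM g x : g \in G1 -> M x -> M (val g *m x).
  by move=> gG Mx; rewrite -G1M; exists g => //; exists x.
have MG g x : g \in G2 -> M x -> M (x *m val g).
  by move=> gG Mx; rewrite -MG2; exists x => //; exists g.
split.
  apply/asboolP; exists 1%g, 1%g, 0; split=> //; rewrite ?gpred1 //.
  exact: scalar_mx_block.
move=> g h /asboolP[g1 [g2 [x [g1G g2G Mx eg]]]].
move=> /asboolP[h1 [h2 [y [h1G h2G My eh]]]]; apply/asboolP.
exists (g1 / h1)%g, (g2 / h2)%g,
  (x *m val (h2^-1)%g - val (g1 / h1)%g *m y *m val (h2^-1)%g).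
have MX : M (x *m val (h2^-1)%g) by apply: MG; rewrite ?gpredV.
split; rewrite ?gpredF //.
  apply: MD => //; apply: MN; apply: MG; rewrite ?gpredV //.
  by apply: GM; rewrite ?gpredF.
set z := (_ - _).
suff e : val g = block_mx (val (g1 / h1)%g) z 0 (val (g2 / h2)%g) *m val h.
  transitivity (val g *m GL_invmx h); first by [].
  by rewrite e -mulmxA GL_mulmxV mulmx1.
have e1 k (a b : GL F k) : val (a / b)%g *m val b = val a.
  by rewrite [val (a / b)%g]/(val a *m GL_invmx b) -mulmxA GL_mulVmx mulmx1.
have e2 k (a : GL F k) : val (a^-1)%g *m val a = 1%:M by exact: GL_mulVmx.
rewrite eg eh mulmx_block !mulmx0 !mul0mx !addr0 !add0r !e1; congr block_mx.
by rewrite /z mulmxBl -!mulmxA e2 !mulmx1 addrC subrK.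
Qed.

Definition block_group : groupClosed (GL F (n + m)) :=
  HB.pack (block_pred M)
    (isMulClosed.Build _ (block_pred M) (group_closedM block_pred_closed))
    (isMul1Closed.Build _ (block_pred M) block_pred_closed.1)
    (isInvClosed.Build _ (block_pred M) (group_closedV block_pred_closed)).

End BlockGroup.

Fact centre_subspace0 : centre_subspace ([set 0] : set 'M[F]_(n, m)).
Proof.
by split=> [//|x y -> ->|a x _ ->]; rewrite /= ?addr0 ?scaler0.
Qed.

Fact mulGM0 : mulGM [set 0] = [set 0].
Proof.
apply/seteqP; split=> [_ [g _ [_ -> <-]]|_ ->]; first exact: mulmx0.
by exists 1%g; rewrite /= ?gpred1 //; exists 0; rewrite ?mulmx0.
Qed.

Fact mulMG0 : mulMG [set 0] = [set 0].
Proof.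
apply/seteqP; split=> [_ [_ -> [g _ <-]]|_ ->]; first exact: mul0mx.
by exists 0 => //; exists 1%g; rewrite /= ?gpred1 ?mul0mx.
Qed.

Definition diag_group : groupClosed (GL F (n + m)) :=
  block_group centre_subspace0 mulGM0 mulMG0.

Lemma diag_sub_block (M : set 'M[F]_(n, m)) (subspM : centre_subspace M)
    (G1M : mulGM M = M) (MG2 : mulMG M = M) :
  {subset diag_group <= block_group subspM G1M MG2}.
Proof.
have M0 : M 0 by case: subspM.
move=> g /asboolP[g1 [g2 [x [g1G g2G x0 eg]]]].
by apply/asboolP; exists g1, g2, x; split=> //; rewrite x0.
Qed.

Definition block_embedding (M : set 'M[F]_(n, m)) (subspM : centre_subspace M)
    (G1M : mulGM M = M) (MG2 : mulMG M = M) :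
    {multiplicative subgroup diag_group
      -> subgroup (block_group subspM G1M MG2)} :=
  subgroup_incl (diag_sub_block subspM G1M MG2).

End Block.

(* Main.v *)
(* Write the big group as a semidirect product V x| D, where V = M and
   D = G1 x G2. Since the diagonal part is a retract, the point is that the
   retraction rho : (x, d) |-> (0, d) acts as the identity on H_q(V x| D).

   The map of V x| D scaling V by a central scalar a <> 0 is conjugation by an
   element of D, so it acts trivially on homology; rho is the scaling by 0.
   Choose q+1 elements a_i of the (infinite) centre all of whose nonempty
   partial sums are nonzero. If the action on H_q of the scaling by a is a
   polynomial of degree at most q in a, then its (q+1)-st difference vanishes,
   so that the alternating sum over J of the scalings by a_J = \sum_(i in J) a_i
   acts as 0, and this sum is (up to sign) rho - id.

   Polynomiality is a statement on Gamma = V^I x| D: the product over i in I of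
   (e_i - id), where e_i kills the i-th coordinate, is zero on H_q(Gamma)
   whenever q < #|I|. It is proved by dimension shifting, one i at a time: if
   N_i is the i-th copy of V, then H_q(Gamma; Z[N_i] (x) A) comes from the
   subgroup x_i = 0, on which e_i = id, and the augmentation ideal of Z[N_i]
   lowers the degree by one. Coefficients in tensor products of such
   augmentation ideals are encoded by simplices carrying a label in the product
   of the sets option V, None standing for an absent factor Z[N_i]. *)
Require Import Defs.
From HB Require Import structures.
From mathcomp Require Import all_boot all_algebra zify.
From mathcomp Require Import boolp classical_sets cardinality.
From mathcomp Require Import generic_quotient ring_quotient.
From mathcomp.multinomials Require Import freeg.

Set Implicit Arguments.
Unset Strict Implicit.
Unset Printing Implicit Defensive.

Import GRing.Theory.

Local Open Scope ring_scope.
Local Open Scope classical_set_scope.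
Local Open Scope quotient_scope.

Lemma freeg_ind (K : choiceType) (P : {freeg K / int} -> Prop) :
  P 0 -> (forall k, P << k >>) -> (forall c c', P c -> P c' -> P (c - c')) ->
  forall c, P c.
Proof.
move=> P0 PU PB c.
have PD a b : P a -> P b -> P (a + b).
  move=> Pa Pb; rewrite (_ : a + b = a - (0 - b)).
    exact: (PB a (0 - b) Pa (PB 0 b P0 Pb)).
  by rewrite sub0r opprK.
rewrite -[c]freeg_sumE; apply: big_ind => // k _.
rewrite -[coeff k c]intz -freegU_mulz; case: (coeff k c) => n.
  by rewrite -pmulrn; elim: n => [|n IH]; rewrite ?mulr0n // mulrS; apply: PD.
rewrite NegzE mulrNz -pmulrn -sub0r; apply: (PB) => //.
by elim: n.+1 => [|m IH]; rewrite ?mulr0n // mulrS; apply: PD.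
Qed.

Lemma fgliftU (K : choiceType) (M : lmodType int) (f : K -> M) k :
  fglift f << k >> = f k.
Proof. by rewrite liftU scale1r. Qed.

Lemma scale_freegU (K : choiceType) (a : int) (k : K) :
  a *: << k >> = << a *g k >> :> {freeg K / int}.
Proof. by rewrite -[X in X *: _]intz scaler_int freegU_mulz intz. Qed.

(* The factor x : X is a label carried along by the simplex v; the degree is
   q - 1, so that hchain X G 0 is the augmentation term. *)
Notation hchain X G q := {freeg (X * q.-tuple G) / int}.

(** * Homogeneous chains with labels *)

Section HomogeneousChains.
Variables (X : choiceType) (G : groupType).
Implicit Types (x : X) (a g : G).

Definition hcons q a : hchain X G q -> hchain X G q.+1 :=
  fglift (fun b => << (b.1, cons_tuple a b.2) >> : hchain X G q.+1).

HB.instance Definition _ q a :=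
  GRing.isZmodMorphism.Build (hchain X G q) (hchain X G q.+1) (@hcons q a)
    (lift_is_additive _).

Lemma hconsU q a x (v : q.-tuple G) :
  hcons a << (x, v) >> = << (x, cons_tuple a v) >>.
Proof. exact: fgliftU. Qed.

(* Recursive form of the alternating sum of the deletions of a vertex:
   d (a :: w) = w - a :: d w. *)
Fixpoint hbd q x : q.+1.-tuple G -> hchain X G q :=
  match q with
  | 0 => fun=> << (x, [tuple]) >>
  | q'.+1 => fun v =>
      << (x, behead_tuple v) >> - hcons (thead v) (hbd x (behead_tuple v))
  end.

Definition hd q : hchain X G q.+1 -> hchain X G q :=
  fglift (fun b => hbd b.1 b.2).

HB.instance Definition _ q :=
  GRing.isZmodMorphism.Build (hchain X G q.+1) (hchain X G q) (@hd q)
    (lift_is_additive _).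

Lemma behead_cons q a (v : q.-tuple G) : behead_tuple (cons_tuple a v) = v.
Proof. exact: val_inj. Qed.

Lemma thead_cons q a (v : q.-tuple G) : thead (cons_tuple a v) = a.
Proof. by []. Qed.

Lemma map_cons_tuple q (H : groupType) (f : G -> H) a (v : q.-tuple G) :
  map_tuple f (cons_tuple a v) = cons_tuple (f a) (map_tuple f v).
Proof. exact: val_inj. Qed.

Lemma tuple_consP q (P : q.+1.-tuple G -> Prop) :
  (forall a v, P (cons_tuple a v)) -> forall v, P v.
Proof.
move=> Pc v; rewrite (tuple_eta v).
rewrite (_ : [tuple of _] = cons_tuple (thead v) (behead_tuple v)) //.
Qed.

Lemma hd_hcons q a (c : hchain X G q.+1) : hd (hcons a c) = c - hcons a (hd c).
Proof.
elim/freeg_ind: c => [|[x v]|c c' IH IH']; first by rewrite !raddf0 addr0.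
  by rewrite hconsU /hd !fgliftU /= thead_cons behead_cons.
by rewrite !raddfB /= IH IH' [RHS]addrACA -opprD.
Qed.

Lemma hdK q (c : hchain X G q.+2) : hd (hd c) = 0.
Proof.
elim/freeg_ind: c => [|[x v]|c c' IH IH']; last 1 first.
- by rewrite !raddfB /= IH IH' subrr.
- by rewrite !raddf0.
elim: q v => [|q IH] v; elim/tuple_consP: v => a v; rewrite -hconsU hd_hcons.
  have -> w : hd << (x, w) >> = << (x, [tuple]) >> :> hchain X G 0.
    exact: fgliftU.
  by rewrite hconsU raddfB /= /hd !fgliftU subrr.
by rewrite raddfB /= hd_hcons IH raddf0 subr0 subrr.
Qed.

End HomogeneousChains.

(* r may be partial: simplices whose label has no image are sent to 0. *)
Section SimplexMap.
Variables (X Y : choiceType) (G H : groupType).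
Variables (r : X -> option Y) (f : X -> G -> H).

Definition vmap q : hchain X G q -> hchain Y H q :=
  fglift (fun b => if r b.1 is Some y then << (y, map_tuple (f b.1) b.2) >>
                   else 0 : hchain Y H q).

HB.instance Definition _ q :=
  GRing.isZmodMorphism.Build (hchain X G q) (hchain Y H q) (@vmap q)
    (lift_is_additive _).

Lemma vmapU q x (v : q.-tuple G) :
  vmap << (x, v) >> =
  if r x is Some y then << (y, map_tuple (f x) v) >> else 0.
Proof. exact: fgliftU. Qed.

Lemma vmap_cons q a x (v : q.-tuple G) :
  vmap << (x, cons_tuple a v) >> = hcons (f x a) (vmap << (x, v) >>).
Proof.
rewrite !vmapU map_cons_tuple; case: (r x) => [y|]; last by rewrite raddf0.
by rewrite hconsU.
Qed.

End SimplexMap.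

Lemma hbd_cons (X : choiceType) (G : groupType) q x a (v : q.+1.-tuple G) :
  hd << (x, cons_tuple a v) >> =
  << (x, v) >> - hcons a (hd << (x, v) >>) :> hchain X G _.
Proof. by rewrite -hconsU hd_hcons. Qed.

Section SimplexMapTheory.
Variables (X Y Z : choiceType) (G H L : groupType).

Lemma hbd_label q x (v : q.+1.-tuple G) (A : zmodType)
    (A1 A2 : {additive hchain X G q -> A}) :
  (forall w, A1 << (x, w) >> = A2 << (x, w) >>) ->
  A1 (hd << (x, v) >>) = A2 (hd << (x, v) >>).
Proof.
elim: q A A1 A2 v => [|q IH] A A1 A2 v eqA; first by rewrite /hd fgliftU eqA.
elim/tuple_consP: v => a v; rewrite hbd_cons !raddfB eqA; congr (_ - _).
by apply: (IH _ (A1 \o hcons a) (A2 \o hcons a)) => w /=; rewrite hconsU.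
Qed.

Lemma eq_vmap (r1 r2 : X -> option Y) (f1 f2 : X -> G -> H) q :
  r1 =1 r2 -> (forall x, r1 x -> f1 x =1 f2 x) ->
  @vmap _ _ _ _ r1 f1 q =1 @vmap _ _ _ _ r2 f2 q.
Proof.
move=> er ef; elim/freeg_ind => [|[x v]|c c' IH IH'].
- by rewrite !raddf0.
- rewrite !vmapU -er; case erx: (r1 x) => [y|//].
  by congr (<< (_, _) >>); apply/val_inj/eq_map/ef; rewrite erx.
- by rewrite !raddfB /= IH IH'.
Qed.

Lemma vmap_comp (r : X -> option Y) (f : X -> G -> H)
    (r' : Y -> option Z) (f' : Y -> H -> L) q (c : hchain X G q) :
  vmap r' f' (vmap r f c) =
  vmap (fun x => obind r' (r x))
    (fun x => if r x is Some y then f' y \o f x else fun=> 1%g) c.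
Proof.
elim/freeg_ind: c => [|[x v]|c c' IH IH']; first by rewrite !raddf0.
  rewrite !vmapU; case: (r x) => [y|]; last by rewrite raddf0.
  rewrite vmapU /=; case: (r' y) => [z|] //; congr (<< (_, _) >>).
  by apply: val_inj; rewrite /= map_comp.
by rewrite !raddfB /= IH IH'.
Qed.

Lemma hd_vmap (r : X -> option Y) (f : X -> G -> H) q (c : hchain X G q.+1) :
  hd (vmap r f c) = vmap r f (hd c).
Proof.
elim/freeg_ind: c => [|[x v]|c c' IH IH']; first by rewrite !raddf0.
  elim: q v => [|q IH] v; elim/tuple_consP: v => a v.
    rewrite vmapU /hd fgliftU vmapU; case: (r x) => [y|]; last first.
      by rewrite raddf0.
    by rewrite fgliftU /=; congr (<< (_, _) >>); exact: val_inj.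
  rewrite vmap_cons hd_hcons hbd_cons raddfB /= IH; congr (_ - _).
  apply: (@hbd_label _ _ _ _ (hcons (f x a) \o @vmap _ _ _ _ r f q)
           (@vmap _ _ _ _ r f q.+1 \o hcons a)) => w /=.
  by rewrite hconsU vmap_cons.
by rewrite !raddfB /= IH IH'.
Qed.

End SimplexMapTheory.

Section Prism.
Variables (X Y : choiceType) (G H : groupType).
Variables (r : X -> option Y) (f g : X -> G -> H).

Lemma vmap_hcons (f0 : G -> H) q a (c : hchain X G q) :
  vmap r (fun=> f0) (hcons a c) = hcons (f0 a) (vmap r (fun=> f0) c).
Proof.
elim/freeg_ind: c => [|[x v]|c c' IH IH']; first by rewrite !raddf0.
  by rewrite hconsU vmap_cons.
by rewrite !raddfB /= IH IH'.
Qed.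

(* The prism operator: the sum over i of
   (-1)^i (f v_0, ..., f v_i, g v_i, ..., g v_(q-1)). *)
Fixpoint prism q y (f0 g0 : G -> H) : q.-tuple G -> hchain Y H q.+1 :=
  match q with
  | 0 => fun=> 0
  | q'.+1 => fun v =>
      hcons (f0 (thead v))
        (<< (y, map_tuple g0 v) >> - prism y f0 g0 (behead_tuple v))
  end.

Definition hprism q : hchain X G q -> hchain Y H q.+1 :=
  fglift (fun b => if r b.1 is Some y then prism y (f b.1) (g b.1) b.2 else 0).

HB.instance Definition _ q :=
  GRing.isZmodMorphism.Build (hchain X G q) (hchain Y H q.+1) (@hprism q)
    (lift_is_additive _).

Lemma hprism0 (c : hchain X G 0) : hprism c = 0.
Proof.
elim/freeg_ind: c => [|[x v]|c c' IH IH']; first by rewrite raddf0.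
  by rewrite /hprism fgliftU; case: (r _).
by rewrite raddfB /= IH IH' subrr.
Qed.

Lemma hprism_cons q x a (v : q.-tuple G) :
  hprism << (x, cons_tuple a v) >> =
  hcons (f x a) (vmap r g << (x, cons_tuple a v) >> - hprism << (x, v) >>).
Proof.
rewrite /hprism !fgliftU vmapU; case: (r x) => [y|] /=; last first.
  by rewrite subrr raddf0.
by rewrite behead_cons thead_cons.
Qed.

Lemma hprism_homotopy q (c : hchain X G q.+1) :
  hd (hprism c) + hprism (hd c) = vmap r g c - vmap r f c.
Proof.
elim/freeg_ind: c => [|[x v]|c c' IH IH']; first by rewrite !raddf0.
  elim: q v => [|q IH] v; elim/tuple_consP: v => a v.
    rewrite hprism_cons !hprism0 addr0 subr0 hd_hcons; congr (_ - _).
    rewrite hd_vmap /hd fgliftU vmap_cons (tuple0 v) /= !vmapU.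
    case: (r x) => [y|//]; rewrite !hconsU.
    by congr (<< (_, _) >>); exact: val_inj.
  rewrite hprism_cons hd_hcons.
  have eP : hprism (hcons a (hd << (x, v) >>)) =
      hcons (f x a)
        (vmap r g (hcons a (hd << (x, v) >>)) - hprism (hd << (x, v) >>)).
    apply: (@hbd_label _ _ _ _ _ _ (@hprism _ \o hcons a)
     (hcons (f x a) \o (@vmap _ _ _ _ r g _ \o hcons a \- @hprism _))) => w /=.
    by rewrite hconsU hprism_cons.
  set c := << (x, v) >> in eP IH *; set W := vmap r g (hcons a (hd c)) in eP.
  have -> : hprism (hd << (x, cons_tuple a v) >>) =
      hprism c - hcons (f x a) (W - hprism (hd c)).
    by rewrite hbd_cons raddfB /= eP.
  have -> : hd (vmap r g << (x, cons_tuple a v) >> - hprism c) =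
      vmap r g c - W - hd (hprism c).
    by rewrite raddfB /= hd_vmap hbd_cons raddfB.
  rewrite (vmap_cons r f) -/c -[vmap r f c](subKr (vmap r g c)) -(IH v) -/c.
  rewrite addrACA subrK -opprD -raddfD; congr (_ - hcons _ _).
  by rewrite addrACA subrK -opprD.
by rewrite !raddfB /= addrACA IH -opprD IH' [RHS]addrACA opprD.
Qed.

End Prism.

Section Relabel.
Variables (X Y Z : choiceType) (G H : groupType).

Lemma relabel_hprism (r : X -> option Y) (f g : X -> G -> H)
    (s : Y -> option Z) q (c : hchain X G q) :
  vmap s (fun=> id) (hprism r f g c) =
  hprism (fun x => obind s (r x)) f g c.
Proof.
elim/freeg_ind: c => [|[x v]|c c' IH IH']; first by rewrite !raddf0.
  elim: q v => [|q IH] v; first by rewrite !hprism0 raddf0.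
  elim/tuple_consP: v => a v; rewrite !hprism_cons vmap_hcons raddfB /= IH.
  congr (hcons _ (_ - _)); rewrite !vmapU; case: (r x) => [y|] /=.
    rewrite vmapU; case: (s y) => [z|//].
    by congr (<< (_, _) >>); apply: val_inj; rewrite /= map_id.
  by rewrite raddf0.
by rewrite !raddfB /= IH IH'.
Qed.

Lemma hprism_relabel (s : X -> option Y) (r : Y -> option Z)
    (f g : Y -> G -> H) (f' g' : X -> G -> H) q (c : hchain X G q) :
  (forall x y, s x = Some y -> f y = f' x /\ g y = g' x) ->
  hprism r f g (vmap s (fun=> id) c) =
  hprism (fun x => obind r (s x)) f' g' c.
Proof.
move=> eqs; elim/freeg_ind: c => [|[x v]|c c' IH IH'].
- by rewrite !raddf0.
- rewrite vmapU; case es: (s x) => [y|]; last first.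
    by rewrite raddf0 /hprism fgliftU /= es.
  rewrite /hprism !fgliftU /= es /=; have [-> ->] := eqs _ _ es.
  by rewrite (_ : map_tuple id v = v) //; apply: val_inj; rewrite /= map_id.
- by rewrite !raddfB /= IH IH'.
Qed.

End Relabel.

Section HeadRelabel.
Variables (X : choiceType) (G : groupType) (s : X -> G -> X).

Definition smap q : hchain X G q.+1 -> hchain X G q.+1 :=
  fglift (fun b => << (s b.1 (thead b.2), b.2) >> : hchain X G q.+1).

HB.instance Definition _ q :=
  GRing.isZmodMorphism.Build (hchain X G q.+1) (hchain X G q.+1) (@smap q)
    (lift_is_additive _).

Lemma smapU q x (v : q.+1.-tuple G) :
  smap << (x, v) >> = << (s x (thead v), v) >>.
Proof. exact: fgliftU. Qed.

Lemma vmap_smap (Y : choiceType) (H : groupType) (r r' : X -> option Y)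
    (f f' : X -> G -> H) q (c : hchain X G q.+1) :
  (forall x a, r (s x a) = r' x) -> (forall x a, f (s x a) =1 f' x) ->
  vmap r f (smap c) = vmap r' f' c.
Proof.
move=> er ef; elim/freeg_ind: c => [|[x v]|c c' IH IH'].
- by rewrite !raddf0.
- rewrite smapU !vmapU er; case: (r' x) => [y|//].
  by congr (<< (_, _) >>); apply: val_inj; apply: eq_map.
- by rewrite !raddfB /= IH IH'.
Qed.

End HeadRelabel.

Lemma smap_vmap (X Y : choiceType) (G H : groupType) (s : X -> G -> X)
    (t : Y -> H -> Y) (r : X -> option Y) (f : X -> G -> H)
    q (c : hchain X G q.+1) :
  (forall x a, r (s x a) = omap (t^~ (f x a)) (r x)) ->
  (forall x a, f (s x a) =1 f x) ->
  vmap r f (smap s c) = smap t (vmap r f c).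
Proof.
move=> er ef; elim/freeg_ind: c => [|[x v]|c c' IH IH'].
- by rewrite !raddf0.
- rewrite smapU !vmapU er; case: (r x) => [y|] /=; last by rewrite raddf0.
  elim/tuple_consP: v => a v; rewrite smapU !map_cons_tuple !thead_cons.
  congr (<< (_, _) >>); apply: val_inj; rewrite /= ef; congr cons.
  exact: eq_map.
- by rewrite !raddfB /= IH IH'.
Qed.

Section Null.
Variables (X : choiceType) (G : groupType) (act : G -> X -> X).

Definition translate g q : hchain X G q -> hchain X G q :=
  vmap (fun x => Some (act g x)) (fun=> *%g g) (q := q).

HB.instance Definition _ g q :=
  GRing.isZmodMorphism.Build (hchain X G q) (hchain X G q) (@translate g q)
    (lift_is_additive _).

(* null c: the image of c among the coinvariants of hchain X G q is zero. *)
Inductive null q : hchain X G q -> Prop :=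
| null0 : null 0
| nullB c c' : null c -> null c' -> null (c - c')
| null_translateU g b : null (translate g << b >> - << b >>).

Lemma nullN q (c : hchain X G q) : null c -> null (- c).
Proof. by rewrite -sub0r; apply: nullB; exact: null0. Qed.

Lemma nullD q (c c' : hchain X G q) : null c -> null c' -> null (c + c').
Proof. by move=> nc nc'; rewrite -[c']opprK; apply/nullB/nullN. Qed.

Lemma null_translate g q (c : hchain X G q) : null (translate g c - c).
Proof.
elim/freeg_ind: c => [|b|c c' IH IH'].
- by rewrite raddf0 subrr; exact: null0.
- exact: null_translateU.
- by rewrite raddfB /= opprD addrACA -opprD; exact: nullB.
Qed.

End Null.

Lemma null_map (X Y : choiceType) (G H : groupType) (actX : G -> X -> X)
    (actY : H -> Y -> Y) p q (A : {additive hchain X G p -> hchain Y H q}) c :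
  (forall g b, null actY (A (translate actX g << b >>) - A << b >>)) ->
  null actX c -> null actY (A c).
Proof.
move=> eqA; elim=> [|c1 c2 _ IH1 _ IH2|g b].
- by rewrite raddf0; exact: null0.
- by rewrite raddfB; exact: nullB.
- by rewrite raddfB.
Qed.

Section Equivariance.
Variables (X Y : choiceType) (G H : groupType).
Variables (actX : G -> X -> X) (actY : H -> Y -> Y).

Definition equivariant (r : X -> option Y) (f : X -> G -> H) :=
  forall g x, if r x is Some y then
    exists2 h, r (actX g x) = Some (actY h y) &
      forall a, f (actX g x) (g * a)%g = (h * f x a)%g
  else r (actX g x) = None.

Lemma translateU g q x (v : q.-tuple G) :
  translate actX g << (x, v) >> = << (actX g x, map_tuple ( *%g g) v) >>.
Proof. exact: vmapU. Qed.

Lemma null_vmap r f q (c : hchain X G q) :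
  equivariant r f -> null actX c -> null actY (vmap r f c).
Proof.
move=> eqv; apply: null_map => g [x v] /=; rewrite translateU.
rewrite vmapU [vmap r f << (x, v) >>]vmapU.
have := eqv g x; case: (r x) => [y [h -> ef]|->]; last first.
  by rewrite subrr; exact: null0.
suff -> : << (actY h y, map_tuple (f (actX g x)) (map_tuple ( *%g g) v)) >> =
    translate actY h << (y, map_tuple (f x) v) >> :> hchain Y H q.
  exact: null_translate.
rewrite /translate vmapU; congr (<< (_, _) >>); apply: val_inj => /=.
by rewrite -!map_comp; apply: eq_map.
Qed.

Lemma null_hd q (c : hchain X G q.+1) : null actX c -> null actX (hd c).
Proof.
apply: null_map => g b /=; rewrite [X in hd X]/translate hd_vmap.
exact: null_translate.
Qed.

Lemma null_smap (s : X -> G -> X) q (c : hchain X G q.+1) :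
  (forall g x a, s (actX g x) (g * a)%g = actX g (s x a)) ->
  null actX c -> null actX (smap s c).
Proof.
move=> es; apply: null_map => g [x v] /=; rewrite translateU !smapU.
set w := map_tuple _ v.
suff -> : << (s (actX g x) (thead w), w) >> =
   translate actX g << (s x (thead v), v) >> :> hchain X G _.
  exact: null_translate.
rewrite translateU; congr (<< (_, _) >>).
rewrite /w; elim/tuple_consP: v {w} => a v.
by rewrite map_cons_tuple !thead_cons es.
Qed.

Lemma null_hprism r f g q (c : hchain X G q) :
  (forall k x, if r x is Some y then
    exists2 h, r (actX k x) = Some (actY h y) &
      forall a, f (actX k x) (k * a)%g = (h * f x a)%g /\
                g (actX k x) (k * a)%g = (h * g x a)%g
  else r (actX k x) = None) ->
  null actX c -> null actY (hprism r f g c).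
Proof.
move=> eqv; apply: null_map => k [x v] /=; rewrite translateU.
have := eqv k x; case rx: (r x) => [y|]; last first.
  move=> rkx; rewrite /hprism !fgliftU /= rx rkx subrr; exact: null0.
case=> h rkx efg.
suff -> : hprism r f g << (actX k x, map_tuple ( *%g k) v) >> =
    translate actY h (hprism r f g << (x, v) >>).
  exact: null_translate.
elim: q v {c} => [|q IH] v; first by rewrite !hprism0 raddf0.
elim/tuple_consP: v => a v; rewrite map_cons_tuple !hprism_cons IH.
rewrite /translate vmap_hcons (efg a).1; congr (hcons _ _).
rewrite raddfB /=; congr (_ - _).
rewrite !vmapU rx rkx vmapU; congr (<< (_, _) >>); apply: val_inj => /=.
rewrite (efg a).2 -!map_comp; congr cons; apply: eq_map => b /=.
exact: (efg b).2.
Qed.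

End Equivariance.

(** * Comparison with the bar complex *)

Section Bar.
Variables (X : choiceType) (G : groupType).

Definition ratios q (v : q.+1.-tuple G) : {ffun 'I_q -> G} :=
  [ffun j : 'I_q => (nth 1 v j)^-1 * nth 1 v j.+1]%g.

Definition to_bar q : hchain X G q.+1 -> {freeg {ffun 'I_q -> G} / int} :=
  fglift (fun b => << ratios b.2 >> : {freeg {ffun 'I_q -> G} / int}).

HB.instance Definition _ q :=
  GRing.isZmodMorphism.Build (hchain X G q.+1) {freeg {ffun 'I_q -> G} / int}
    (@to_bar q) (lift_is_additive _).

Lemma to_barU q x (v : q.+1.-tuple G) : to_bar << (x, v) >> = << ratios v >>.
Proof. exact: fgliftU. Qed.

Definition del q (i : nat) (v : q.+1.-tuple G) : q.-tuple G :=
  [tuple nth 1%g v (bump i j) | j < q].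

Lemma nth_del q i (v : q.+1.-tuple G) k :
  (k < q)%N -> nth 1%g (del i v) k = nth 1%g v (bump i k).
Proof.
by move=> ltk; rewrite -[k in LHS]/(nat_of_ord (Ordinal ltk)) nth_mktuple.
Qed.

Lemma del_cons q i a (v : q.+1.-tuple G) :
  del i.+1 (cons_tuple a v) = cons_tuple a (del i v).
Proof.
apply/val_inj/(@eq_from_nth _ 1%g); first by rewrite !size_tuple.
move=> j; rewrite size_tuple => ltj; rewrite nth_del //.
by case: j ltj => [|j] ltj //=; rewrite nth_del // /bump ltnS addnS.
Qed.

Lemma del0 q a (v : q.-tuple G) : del 0 (cons_tuple a v) = v.
Proof.
apply/val_inj/(@eq_from_nth _ 1%g); first by rewrite !size_tuple.
by move=> j; rewrite size_tuple => ltj; rewrite nth_del.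
Qed.

Lemma hd_sum q x (v : q.+1.-tuple G) :
  hd << (x, v) >> =
  \sum_(i < q.+1) << (-1) ^+ i *g (x, del i v) >> :> hchain X G q.
Proof.
elim: q v => [|q IH] v; elim/tuple_consP: v => a v.
  by rewrite big_ord1 /hd fgliftU expr0 /= del0 (tuple0 v).
rewrite hbd_cons big_ord_recl del0; congr (_ + _).
rewrite IH raddf_sum -sumrN; apply: eq_bigr => i _ /=.
by rewrite del_cons exprS mulN1r -freegUN /hcons liftU scale_freegU.
Qed.

Lemma face_ratios q (i : 'I_q.+2) (v : q.+2.-tuple G) :
  face i (ratios v) = ratios (del i v).
Proof.
apply/ffunP=> j; rewrite !ffunE /= /bump /= add1n.
rewrite !nth_del; [| have := ltn_ord j; lia ..].
rewrite /bump; case: ltngtP => [lt|gt|e].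
- have -> : (i <= j)%N = false by lia.
  by rewrite !add0n.
- have -> : (i <= j)%N = true by lia.
  by rewrite !add1n.
- by rewrite -e ltnn add0n mulgA mulgK.
Qed.

Lemma to_bar_hd q (c : hchain X G q.+2) :
  to_bar (hd c) = @differential G q.+1 (to_bar c).
Proof.
elim/freeg_ind: c => [|[x v]|c c' IH IH'].
- by rewrite !raddf0.
- rewrite to_barU /differential fgliftU hd_sum raddf_sum.
  apply: eq_bigr => i _ /=.
  by rewrite face_ratios /to_bar liftU scale_freegU.
- by rewrite !raddfB /= IH IH'.
Qed.

End Bar.

Section BarCoinvariants.
Variables (X : choiceType) (G : groupType) (act : G -> X -> X).

Lemma ratios_translate g q (v : q.+1.-tuple G) :
  ratios (map_tuple ( *%g g) v) = ratios v.
Proof.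
apply/ffunP=> j; have ltj := ltn_ord j.
rewrite !ffunE !(nth_map 1%g) ?size_tuple ?ltnS ?(ltnW ltj) //.
by rewrite invgM -mulgA mulKg.
Qed.

Lemma to_bar_null q (c : hchain X G q.+1) : null act c -> to_bar c = 0.
Proof.
elim=> [|c1 c2 _ e1 _ e2|g [x v]]; first by rewrite raddf0.
  by rewrite raddfB /= e1 e2 subrr.
by rewrite raddfB /= translateU !to_barU ratios_translate subrr.
Qed.

End BarCoinvariants.

Section BarLift.
Variables (X : choiceType) (G : groupType).

Definition partial_prod q (g : {ffun 'I_q -> G}) i : G :=
  (\prod_(0 <= k < i) oapp g 1 (insub k))%g.

Definition of_bar (x : X) q :
    {freeg {ffun 'I_q -> G} / int} -> hchain X G q.+1 :=
  fglift (fun g => << (x, [tuple partial_prod g i | i < q.+1]) >> :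
    hchain X G q.+1).

HB.instance Definition _ x q :=
  GRing.isZmodMorphism.Build {freeg {ffun 'I_q -> G} / int} (hchain X G q.+1)
    (@of_bar x q) (lift_is_additive _).

Lemma of_barU x q (g : {ffun 'I_q -> G}) :
  of_bar x << g >> = << (x, [tuple partial_prod g i | i < q.+1]) >>.
Proof. exact: fgliftU. Qed.

Lemma nth_mktuple_nat (T : Type) (x0 : T) q (F : nat -> T) k : (k < q)%N ->
  nth x0 [tuple F i | i < q] k = F k.
Proof.
by move=> ltk; rewrite -[k in LHS]/(nat_of_ord (Ordinal ltk)) nth_mktuple.
Qed.

Lemma partial_prodS q (g : {ffun 'I_q -> G}) (j : 'I_q) :
  partial_prod g j.+1 = (partial_prod g j * g j)%g.
Proof. by rewrite /partial_prod big_nat_recr //= valK. Qed.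

Lemma of_barK x q : cancel (@of_bar x q) (@to_bar X G q).
Proof.
elim/freeg_ind => [|g|c c' IH IH']; first by rewrite !raddf0.
  rewrite of_barU to_barU; congr << _ >>; apply/ffunP=> j; rewrite ffunE.
  rewrite !nth_mktuple_nat ?ltnS // 1?ltnW //.
  by rewrite partial_prodS mulKg.
by rewrite !raddfB /= IH IH'.
Qed.

(* A simplex is the translate by its first vertex of the one lifted from its
   ratios; a label fixed by G is unaffected. *)
Lemma of_to_bar (act : G -> X -> X) x (xG : forall g, act g x = x) q
    (v : q.+1.-tuple G) :
  null act (<< (x, v) >> - of_bar x (to_bar << (x, v) >>)).
Proof.
rewrite to_barU of_barU; set w := [tuple _ | i < _].
suff -> : << (x, v) >> = translate act (nth 1%g v 0) << (x, w) >>.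
  exact: null_translate.
rewrite translateU xG; congr << (_, _) >>.
apply/val_inj/(@eq_from_nth _ 1%g); first by rewrite !size_tuple.
move=> k; rewrite size_tuple => ltk; rewrite (nth_map 1%g) ?size_tuple //.
rewrite nth_mktuple_nat //; elim: k ltk => [|k IH] ltk.
  by rewrite /partial_prod big_nil mulg1.
rewrite -[k]/(nat_of_ord (Ordinal (ltk : k < q)%N)) partial_prodS mulgA.
by rewrite -IH ?ffunE /= ?mulVKg // ltnW.
Qed.

End BarLift.

Lemma gmulfVM (G H : groupType) (f : {multiplicative G -> H}) a b :
  f (a^-1 * b)%g = ((f a)^-1 * f b)%g.
Proof. by apply: (mulgI (f a)); rewrite -gmulfM !mulVKg. Qed.

Lemma eq_chain_map (G H : groupType) (f f' : {multiplicative G -> H}) q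
    (c : chain G q) :
  f =1 f' -> chain_map f c = chain_map f' c.
Proof.
move=> ef; elim/freeg_ind: c => [|g|c c' IH IH']; first by rewrite !raddf0.
  rewrite /chain_map !fgliftU; congr << _ >>.
  by apply/ffunP=> j; rewrite !ffunE.
by rewrite !raddfB /= IH IH'.
Qed.

Lemma chain_map_comp (G H K : groupType) (f : {multiplicative H -> K})
    (g : {multiplicative G -> H}) q (c : chain G q) :
  chain_map f (chain_map g c) = chain_map (f \o g : {multiplicative G -> K}) c.
Proof.
elim/freeg_ind: c => [|v|c c' IH IH']; first by rewrite !raddf0.
  rewrite /chain_map !fgliftU; congr << _ >>.
  by apply/ffunP=> j; rewrite !ffunE.
by rewrite !raddfB /= IH IH'.
Qed.

Lemma chain_map_id (G : groupType) (f : {multiplicative G -> G}) q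
    (c : chain G q) :
  f =1 id -> chain_map f c = c.
Proof.
move=> fid; elim/freeg_ind: c => [|v|c c' IH IH']; first by rewrite !raddf0.
  rewrite /chain_map !fgliftU; congr << _ >>.
  by apply/ffunP=> j; rewrite !ffunE fid.
by rewrite !raddfB /= IH IH'.
Qed.

Section InnerAutomorphism.
Variable G : groupType.

Let triv (g : G) (x : unit) := x.

Lemma to_bar_vmap (X Y : choiceType) (H : groupType)
    (f : {multiplicative G -> H}) (r : X -> Y) q (c : hchain X G q.+1) :
  to_bar (vmap (Some \o r) (fun=> f) c) = chain_map f (to_bar c).
Proof.
elim/freeg_ind: c => [|[x v]|c c' IH IH'].
- by rewrite !raddf0.
- rewrite vmapU !to_barU /chain_map fgliftU; congr << _ >>.
  apply/ffunP=> j; have ltj := ltn_ord j.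
  by rewrite !ffunE !(nth_map 1%g) ?size_tuple ?ltnS ?(ltnW ltj) // gmulfVM.
- by rewrite !raddfB /= IH IH'.
Qed.

Lemma null_of_to_bar q (c : hchain unit G q.+1) :
  null triv (c - of_bar tt (to_bar c)).
Proof.
elim/freeg_ind: c => [|[[] v]|c c' IH IH'].
- by rewrite !raddf0 addr0; exact: null0.
- exact: of_to_bar.
- by rewrite raddfB raddfB /= opprD addrACA -opprD; apply: nullB.
Qed.

Lemma hd_of_bar q (z : chain G q) : differential z = 0 ->
  q = 0 \/ null triv (hd (of_bar tt z)).
Proof.
case: q z => [|q] z dz; [by left | right].
have := null_of_to_bar (hd (of_bar tt z)).
by rewrite to_bar_hd of_barK [differential _]dz raddf0 subr0.
Qed.

Lemma chain_map_inner (f : {multiplicative G -> G}) t q (z : chain G q) :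
  (forall g, f g = t * g * t^-1)%g -> differential z = 0 ->
  exists b : chain G q.+1, chain_map f z - z = differential b.
Proof.
move=> ft dz; set c := of_bar tt z.
pose r (x : unit) := Some x; pose f0 (x : unit) (a : G) := a.
pose g0 (x : unit) (a : G) := (a * t^-1)%g.
have eqv : forall k x, if r x is Some y then
    exists2 h, r (triv k x) = Some (triv h y) &
      forall a, f0 (triv k x) (k * a)%g = (h * f0 x a)%g /\
                g0 (triv k x) (k * a)%g = (h * g0 x a)%g
    else r (triv k x) = None.
  by move=> k x /=; exists k => // a; split; rewrite // /g0 mulgA.
exists (to_bar (hprism r f0 g0 c)).
rewrite -to_bar_hd.
have -> : hd (hprism r f0 g0 c) =
    vmap r g0 c - vmap r f0 c - hprism r f0 g0 (hd c).
  by rewrite -hprism_homotopy addrK.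
have n0 : to_bar (hprism r f0 g0 (hd c)) = 0.
  have := hd_of_bar dz; rewrite -/c; case=> [q0 | nc].
    by move: (hd c); rewrite q0 => c0; rewrite hprism0 raddf0.
  by apply: (@to_bar_null _ _ triv); apply: null_hprism nc.
rewrite raddfB /= n0 subr0 raddfB /=; congr (_ - _).
  have -> : z = to_bar c by rewrite of_barK.
  rewrite -(to_bar_vmap f id); elim/freeg_ind: {n0} c => [|[x v]|c c' IH IH'].
  - by rewrite !raddf0.
  - rewrite !vmapU !to_barU; congr << _ >>.
    apply/ffunP=> j; have ltj := ltn_ord j.
    rewrite !ffunE !(nth_map 1%g) ?size_tuple ?ltnS ?(ltnW ltj) // -gmulfVM ft.
    by rewrite /g0 invgM invgK !mulgA.
  - by rewrite !raddfB /= IH IH'.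
apply: esym; rewrite -[RHS](of_barK tt) -/c; congr (to_bar _).
elim/freeg_ind: {n0} c => [|[x v]|c c' IH IH']; first by rewrite raddf0.
  by rewrite vmapU; congr << (_, _) >>; apply: val_inj; rewrite /= map_id.
by rewrite raddfB /= IH IH'.
Qed.

End InnerAutomorphism.

(** * Cross effects of semidirect products *)

Record gmodule (D : groupType) (V : zmodType) := GModule {
  gact :> D -> V -> V;
  gactB : forall d, {morph gact d : x y / x - y};
  gact1 : gact 1%g =1 id;
  gactM : forall d e x, gact (d * e)%g x = gact d (gact e x)
}.

Section GModuleTheory.
Variables (D : groupType) (V : zmodType) (m : gmodule D V).

Lemma gact0 d : m d 0 = 0.
Proof. by rewrite -[RHS](subrr (m d 0)) -gactB subr0. Qed.

Lemma gactN d : {morph m d : x / - x}.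
Proof. by move=> x; rewrite -sub0r gactB gact0 sub0r. Qed.

Lemma gactD d : {morph m d : x y / x + y}.
Proof. by move=> x y; rewrite -[y in LHS]opprK gactB gactN opprK. Qed.

Lemma gactKV d : cancel (m d^-1)%g (m d).
Proof. by move=> x; rewrite -gactM mulgV gact1. Qed.

End GModuleTheory.

Definition sdp (D : groupType) (V : zmodType) (m : gmodule D V) : Type :=
  (V * D)%type.

HB.instance Definition _ D V (m : gmodule D V) := Choice.on (sdp m).

Section SemidirectProduct.
Variables (D : groupType) (V : zmodType) (m : gmodule D V).

Definition sdp_mul (g h : sdp m) : sdp m := (g.1 + m g.2 h.1, (g.2 * h.2)%g).
Definition sdp_one : sdp m := (0, 1%g).
Definition sdp_inv (g : sdp m) : sdp m := (- m (g.2^-1)%g g.1, (g.2^-1)%g).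

Fact sdp_mulA : associative sdp_mul.
Proof.
by move=> g h k; rewrite /sdp_mul /= gactD gactM !addrA mulgA.
Qed.
Fact sdp_mul1 : left_id sdp_one sdp_mul.
Proof. by case=> x d; rewrite /sdp_mul /= gact1 add0r mul1g. Qed.
Fact sdp_1mul : right_id sdp_one sdp_mul.
Proof. by case=> x d; rewrite /sdp_mul /= gact0 addr0 mulg1. Qed.
Fact sdp_mulV : left_inverse sdp_one sdp_inv sdp_mul.
Proof. by case=> x d; rewrite /sdp_mul /= addNr mulVg. Qed.
Fact sdp_Vmul : right_inverse sdp_one sdp_inv sdp_mul.
Proof. by case=> x d; rewrite /sdp_mul /= gactN gactKV subrr mulgV. Qed.

HB.instance Definition _ :=
  isGroup.Build (sdp m) sdp_mulA sdp_mul1 sdp_1mul sdp_mulV sdp_Vmul.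

Lemma sdpME (g h : sdp m) : (g * h)%g = (g.1 + m g.2 h.1, (g.2 * h.2)%g).
Proof. by []. Qed.

End SemidirectProduct.

Section PowerModule.
Variables (D : groupType) (V : zmodType) (m : gmodule D V) (I : finType).

Definition ffun_act d (x : {ffun I -> V}) : {ffun I -> V} :=
  [ffun i => m d (x i)].

Fact ffun_actB d : {morph ffun_act d : x y / x - y}.
Proof. by move=> x y; apply/ffunP=> i; rewrite !ffunE gactB. Qed.
Fact ffun_act1 : ffun_act 1%g =1 id.
Proof. by move=> x; apply/ffunP=> i; rewrite !ffunE gact1. Qed.
Fact ffun_actM d e x : ffun_act (d * e)%g x = ffun_act d (ffun_act e x).
Proof. by apply/ffunP=> i; rewrite !ffunE gactM. Qed.

Definition ffun_gmodule := GModule ffun_actB ffun_act1 ffun_actM.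

End PowerModule.

Section CrossEffects.
Variables (D : groupType) (V : zmodType) (m : gmodule D V) (I : finType).

Local Notation Gam := (sdp (ffun_gmodule m I)).
Local Notation L := {ffun I -> option V}.
Implicit Types (i j k : I) (n : L) (g h : Gam).

Definition lact g n : L := [ffun j => omap (fun y => g.1 j + m g.2 y) (n j)].

Definition setl k (o : option V) n : L := [ffun j => if j == k then o else n j].

Definition kill (S : {set I}) g : Gam :=
  ([ffun j => if j \in S then 0 else g.1 j], g.2).

Fact kill_is_mul S : {morph kill S : g h / (g * h)%g}.
Proof.
move=> g h; rewrite !sdpME; congr (_, _); apply/ffunP=> j; rewrite !ffunE /=.
by case: ifP => _; rewrite ?gact0 ?addr0 //.
Qed.

(* With N_k the G-set V on which (x, d) acts by y |-> x k + d y, a label that is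
   Some y at k is a simplex with coefficients in Z[N_k]: drop_coef k is the
   augmentation of Z[N_k], while lift0 k splits it by the base point 0 of N_k,
   moved to the first vertex of the simplex. lift0 is not a chain map, and its
   failure to be one is the connecting map of the dimension shift. *)
Definition forget k n := Some (setl k None n).
Definition drop_coef k n := if n k is Some _ then forget k n else None.
Definition elem k y : Gam := ([ffun j => if j == k then y else 0], 1%g).

Definition forget_map k q : hchain L Gam q -> hchain L Gam q :=
  vmap (forget k) (fun=> id) (q := q).
Definition kill_map k q : hchain L Gam q -> hchain L Gam q :=
  vmap (forget k) (fun=> kill [set k]) (q := q).
Definition coef_map k q : hchain L Gam q -> hchain L Gam q :=
  vmap (drop_coef k) (fun=> id) (q := q).
Definition lift0 k q : hchain L Gam q.+1 -> hchain L Gam q.+1 :=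
  smap (fun n (g : Gam) => setl k (Some (g.1 k)) n) (q := q).
(* Left translation by elem k y intertwines, over the label y of N_k, the identity
   with the killing of the k-th coordinate: see slide_equiv. *)
Definition slide k n g : Gam := (elem k (odflt 0 (n k)) * kill [set k] g)%g.
Definition homot k q : hchain L Gam q -> hchain L Gam q.+1 :=
  hprism (drop_coef k) (fun=> id) (slide k) (q := q).
HB.instance Definition _ k q :=
  GRing.isZmodMorphism.Build _ _ (@forget_map k q) (lift_is_additive _).
HB.instance Definition _ k q :=
  GRing.isZmodMorphism.Build _ _ (@kill_map k q) (lift_is_additive _).
HB.instance Definition _ k q :=
  GRing.isZmodMorphism.Build _ _ (@coef_map k q) (lift_is_additive _).
HB.instance Definition _ k q :=
  GRing.isZmodMorphism.Build _ _ (@lift0 k q) (lift_is_additive _).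
HB.instance Definition _ k q :=
  GRing.isZmodMorphism.Build _ _ (@homot k q) (lift_is_additive _).

Fixpoint cross (s : seq I) q (c : hchain L Gam q) : hchain L Gam q :=
  if s is i :: s' then cross s' (kill_map i c - forget_map i c) else c.

Fact cross_is_zmod_morphism s q : zmod_morphism (@cross s q).
Proof.
elim: s => [//|i s IH] x y /=; rewrite -IH; congr cross.
by rewrite !raddfB /= addrACA.
Qed.

HB.instance Definition _ s q :=
  GRing.isZmodMorphism.Build (hchain L Gam q) (hchain L Gam q) (@cross s q)
    (@cross_is_zmod_morphism s q).

Lemma crossC s p q (A : {additive hchain L Gam p -> hchain L Gam q}) c :
  (forall i, i \in s -> (forall c, kill_map i (A c) = A (kill_map i c)) /\
                        (forall c, forget_map i (A c) = A (forget_map i c))) ->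
  cross s (A c) = A (cross s c).
Proof.
elim: s c => [//|i s IH] c eqA /=.
have [eA pA] := eqA i (mem_head _ _).
rewrite eA pA -raddfB IH // => j sj; apply: eqA; exact: mem_behead.
Qed.


Lemma setlE k o n j : setl k o n j = if j == k then o else n j.
Proof. by rewrite ffunE. Qed.

Lemma setlC i k o o' n : i != k ->
  setl i o (setl k o' n) = setl k o' (setl i o n).
Proof.
move=> neik; apply/ffunP=> j; rewrite !ffunE.
by have [->|] := eqVneq j i; rewrite ?(negbTE neik).
Qed.

Lemma setlK k o o' n : setl k o (setl k o' n) = setl k o n.
Proof. by apply/ffunP=> j; rewrite !ffunE; case: eqP. Qed.

Lemma killC S T g : kill S (kill T g) = kill T (kill S g).
Proof.
congr (_, _); apply/ffunP=> j; rewrite !ffunE /= ?ffunE.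
by do 2!case: ifP => //.
Qed.

Lemma lact_forget k g n : lact g (setl k None n) = setl k None (lact g n).
Proof. by apply/ffunP=> j; rewrite !ffunE; case: eqP. Qed.

Lemma lact_kill k g n :
  lact (kill [set k] g) (setl k None n) = lact g (setl k None n).
Proof.
by apply/ffunP=> j; rewrite !ffunE /= ?ffunE inE; case: eqP.
Qed.

Lemma lact_elem k y n : lact (elem k y) (setl k None n) = setl k None n.
Proof.
apply/ffunP=> j; rewrite !ffunE /= ?ffunE; case: eqP => //= _.
by case: (n j) => //= z; rewrite gact1 add0r.
Qed.

Lemma slide_equiv k g n y h : n k = Some y ->
  slide k (lact g n) (g * h)%g = (g * slide k n h)%g.
Proof.
move=> nk; rewrite /slide !ffunE nk kill_is_mul mulgA [RHS]mulgA.
congr (_ * _)%g; rewrite !sdpME /= mul1g mulg1; congr (_, _).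
apply/ffunP=> j; rewrite !ffunE /= ?ffunE inE.
by case: eqP => [->|_]; rewrite ?gact0 ?addr0 ?add0r ?gact1.
Qed.

Lemma drop_coefP k g n :
  if drop_coef k n is Some n' then drop_coef k (lact g n) = Some (lact g n')
  else drop_coef k (lact g n) = None.
Proof.
rewrite /drop_coef ffunE; case: (n k) => [y|//] /=.
by rewrite /forget lact_forget.
Qed.

Lemma null_forget_map k q (c : hchain L Gam q) :
  null lact c -> null lact (forget_map k c).
Proof.
apply: null_vmap => g n /=; exists g => //.
by rewrite /forget lact_forget.
Qed.

Lemma null_kill_map k q (c : hchain L Gam q) :
  null lact c -> null lact (kill_map k c).
Proof.
apply: null_vmap => g n /=; exists (kill [set k] g); last exact: kill_is_mul.
by rewrite /forget lact_kill lact_forget.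
Qed.

Lemma null_lift0 k q (c : hchain L Gam q.+1) :
  null lact c -> null lact (lift0 k c).
Proof.
apply: null_smap => g n h; apply/ffunP=> j; rewrite !ffunE /=.
by case: eqP => [->|//].
Qed.

Lemma null_homot k q (c : hchain L Gam q) :
  null lact c -> null lact (homot k c).
Proof.
apply: null_hprism => g n; have := drop_coefP k g n.
case dk: (drop_coef k n) => [n'|] // e; exists g => // h; split=> //.
have [y nk] : exists y, n k = Some y.
  by move: dk; rewrite /drop_coef; case: (n k) => // y _; exists y.
exact: slide_equiv nk.
Qed.

Lemma null_cross s q (c : hchain L Gam q) :
  null lact c -> null lact (cross s c).
Proof.
elim: s c => [//|i s IH] c nc /=; apply/IH/nullB; first exact: null_kill_map.
exact: null_forget_map.
Qed.


Lemma vmapC (r r' : L -> option L) (a b : Gam -> Gam) q (c : hchain L Gam q) :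
  (forall n, obind r (r' n) = obind r' (r n)) ->
  (forall g, a (b g) = b (a g)) ->
  vmap r (fun=> a) (vmap r' (fun=> b) c) =
  vmap r' (fun=> b) (vmap r (fun=> a) c).
Proof.
move=> er eab; rewrite !vmap_comp; apply: eq_vmap => // n; have := er n.
by case: (r' n) => [y|//]; case: (r n) => [z|] /= -> //= _ g; exact: eab.
Qed.

Lemma setlNC i k n : setl i None (setl k None n) = setl k None (setl i None n).
Proof. by apply/ffunP=> j; rewrite !ffunE; do 2!case: eqP. Qed.

Lemma drop_forgetC i k n : i != k ->
  obind (forget i) (drop_coef k n) = drop_coef k (setl i None n).
Proof.
move=> neik; rewrite /drop_coef setlE eq_sym (negbTE neik).
by case: (n k) => [y|//]; rewrite /= /forget setlNC.
Qed.

Lemma cross_kill_map s k q (c : hchain L Gam q) :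
  cross s (kill_map k c) = kill_map k (cross s c).
Proof.
apply: (crossC (A := @kill_map k q)) => i _.
split=> c'; apply: vmapC => [n|g] //=.
- by rewrite /forget setlNC.
- exact: killC.
- by rewrite /forget setlNC.
Qed.

Lemma cross_coef_map s k q (c : hchain L Gam q) : k \notin s ->
  cross s (coef_map k c) = coef_map k (cross s c).
Proof.
move=> sk; apply: (crossC (A := @coef_map k q)) => i si.
have neik : i != k by apply: contraNneq sk => <-.
by split=> c'; apply: vmapC => [n|g] //=; exact: drop_forgetC.
Qed.

Lemma cross_hd s q (c : hchain L Gam q.+1) : cross s (hd c) = hd (cross s c).
Proof.
by apply: (crossC (A := @hd L Gam q)) => i _; split=> c'; exact/esym/hd_vmap.
Qed.

Lemma lift0_coef_map j k q (c : hchain L Gam q.+1) : j != k ->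
  coef_map j (lift0 k c) = lift0 k (coef_map j c).
Proof.
move=> nejk; apply: smap_vmap => // n g; rewrite /drop_coef setlE (negbTE nejk).
by case: (n j) => [y|//]; rewrite /= /forget setlC.
Qed.

Lemma coef_map_lift0 k q (c : hchain L Gam q.+1) :
  coef_map k (lift0 k c) = forget_map k c.
Proof.
by apply: vmap_smap => // n g; rewrite /drop_coef setlE eqxx /forget setlK.
Qed.

Lemma kill_map_forget_map k q (c : hchain L Gam q) :
  kill_map k (forget_map k c) = kill_map k c.
Proof.
rewrite /kill_map /forget_map vmap_comp; apply: eq_vmap => n /=; last by [].
by rewrite /forget setlK.
Qed.

Lemma coef_map_homot j k q (c : hchain L Gam q) : j != k ->
  coef_map j (homot k c) = homot k (coef_map j c).
Proof.
move=> nejk; rewrite /coef_map /homot relabel_hprism.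
rewrite (@hprism_relabel _ _ _ _ _ _ _ _ _ (fun=> id) (slide k)); last first.
  move=> n n'; rewrite /drop_coef; case: (n j) => // y [<-]; split=> //.
  by rewrite /slide setlE eq_sym (negbTE nejk).
congr (hprism _ _ _ c); apply: funext => n.
have nekj : k != j by rewrite eq_sym.
rewrite /drop_coef; case nk: (n k) => [y|]; case nj: (n j) => [z|] //=.
- by rewrite !setlE (negbTE nejk) (negbTE nekj) nj nk /forget setlNC.
- by rewrite setlE (negbTE nejk) nj.
- by rewrite setlE (negbTE nekj) nk.
Qed.

(* The slide homotopy ends at the map killing the coordinate k, up to the
   translation by elem k (n k), which fixes all the other labels. *)
Lemma null_slide k q (c : hchain L Gam q) :
  null lact (vmap (drop_coef k) (slide k) c - kill_map k (coef_map k c)).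
Proof.
elim/freeg_ind: c => [|[n v]|c c' IH IH'].
- by rewrite !raddf0 addr0; exact: null0.
- rewrite /coef_map !vmapU /drop_coef; case nk: (n k) => [y|]; last first.
    by rewrite !raddf0 addr0; exact: null0.
  rewrite /kill_map vmapU /= setlK.
  set b := << (_, map_tuple (kill _) _) >>.
  suff -> : << (setl k None n, map_tuple (slide k n) v) >> =
      translate lact (elem k y) b by exact: null_translate.
  rewrite translateU lact_elem; congr << (_, _) >>; apply: val_inj => /=.
  by rewrite map_id -map_comp /slide nk.
- by rewrite !raddfB /= addrACA -opprD; exact: nullB.
Qed.

(* The condition on coef_map says that the coefficients at the j outside s lie
   in the augmentation ideal of Z[N_j]. *)
Lemma cross_boundary s q (c : hchain L Gam q.+1) :
  uniq s -> (q < size s)%N -> q = 0 \/ null lact (hd c) ->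
  (forall j, j \notin s -> null lact (coef_map j c)) ->
  exists2 b : hchain L Gam q.+2, null lact (cross s c - hd b) &
    forall j, j \notin s -> null lact (coef_map j b).
Proof.
elim: s q c => [//|i s IH] q c /= /andP[si us] leqs dc qc.
have qc0 j : j \notin i :: s -> null lact (coef_map j (lift0 i c)).
  rewrite inE negb_or => /andP[neji sj]; rewrite lift0_coef_map //.
  by apply: null_lift0; apply: qc; rewrite inE negb_or neji.
have [w [dw qw qwj]] : exists w : hchain L Gam q.+1,
    [/\ q = 0 \/ null lact (hd w),
        null lact (coef_map i w - cross s (forget_map i c))
      & forall j, j \notin i :: s -> null lact (coef_map j w)].
  case: q => [|q] in c leqs dc qc qc0 *.
    exists (cross s (lift0 i c)); split; first by left.
      by rewrite -cross_coef_map // coef_map_lift0 subrr; exact: null0.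
    move=> j sj; rewrite -cross_coef_map; first exact/null_cross/qc0.
    by move: sj; rewrite inE negb_or => /andP[].
  case: dc => // dc.
  have [|j sj|b db qb] := IH q (hd (lift0 i c)) us leqs.
  - by right; rewrite hdK; exact: null0.
  - rewrite /coef_map -hd_vmap; have [->|neji] := eqVneq j i.
      rewrite -/(coef_map i _) coef_map_lift0 hd_vmap; exact: null_forget_map.
    by apply: null_hd; apply: qc0; rewrite inE negb_or neji.
  exists (cross s (lift0 i c) - b); split.
  - by right; rewrite raddfB /= -cross_hd.
  - rewrite raddfB /= -cross_coef_map // coef_map_lift0 addrAC subrr add0r.
    by apply/nullN/qb.
  - move=> j; rewrite inE negb_or => /andP[neji sj].
    rewrite raddfB /= -cross_coef_map //; apply: nullB; last exact: qb.
    by apply/null_cross/qc0; rewrite inE negb_or neji.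
exists (homot i w); last first.
  move=> j sj; rewrite coef_map_homot; first exact/null_homot/qwj.
  by move: sj; rewrite inE negb_or => /andP[].
have hdw : null lact (homot i (hd w)).
  case: dw => [q0 | ]; last exact: null_homot.
  by move: (hd w); rewrite q0 => w0; rewrite /homot hprism0; exact: null0.
have -> : hd (homot i w) =
    vmap (drop_coef i) (slide i) w - coef_map i w - homot i (hd w).
  by rewrite -hprism_homotopy addrK.
set a := vmap _ _ w.
have na : null lact (a - cross s (kill_map i c)).
  rewrite -[a](subrK (kill_map i (coef_map i w))) -addrA; apply: nullD.
    exact: null_slide.
  rewrite -(kill_map_forget_map _ c) cross_kill_map -raddfB.
  exact: null_kill_map.
rewrite raddfB /=.
have -> : cross s (kill_map i c) - cross s (forget_map i c) -
      (a - coef_map i w - homot i (hd w)) =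
    homot i (hd w) - (a - cross s (kill_map i c)) +
      (coef_map i w - cross s (forget_map i c)).
  rewrite !opprB addrCA -[RHS]addrA; congr (_ + _).
  by rewrite addrACA [RHS]addrACA; congr (_ + _); rewrite addrC.
by apply: nullD => //; exact: nullB.
Qed.

End CrossEffects.

Section SdpMap.
Variables (D : groupType) (V W : zmodType).
Variables (m : gmodule D V) (m' : gmodule D W) (beta : V -> W).
Hypotheses (betaB : {morph beta : x y / x - y}).
Hypotheses (betaE : forall d x, beta (m d x) = m' d (beta x)).

Definition sdp_map (g : sdp m) : sdp m' := (beta g.1, g.2).

Fact sdp_map_is_mul : {morph sdp_map : g h / (g * h)%g}.
Proof.
move=> g h; rewrite !sdpME /sdp_map /=; congr (_, _).
rewrite -[m g.2 _]opprK betaB -betaE -[h.1 in RHS]opprK; congr (_ + _).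
have b0 : beta 0 = 0 by rewrite -[RHS](subrr (beta 0)) -betaB subr0.
by rewrite -sub0r -b0 -betaB sub0r !opprK.
Qed.

Definition sdp_hom : {multiplicative sdp m -> sdp m'} :=
  HB.pack sdp_map (isMultiplicative.Build _ _ sdp_map sdp_map_is_mul).

End SdpMap.

Definition is_bound (G : groupType) q (z : chain G q) :=
  exists b : chain G q.+1, z = differential b.

Lemma is_bound0 (G : groupType) q : is_bound (0 : chain G q).
Proof. by exists 0; rewrite raddf0. Qed.

Lemma is_boundB (G : groupType) q (x y : chain G q) :
  is_bound x -> is_bound y -> is_bound (x - y).
Proof. by move=> [b ->] [c ->]; exists (b - c); rewrite raddfB. Qed.

Section Contraction.
Variables (D : groupType) (V : zmodType) (m : gmodule D V) (I : finType).
Variables (alpha : I -> V -> V).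
Hypotheses (alphaB : forall i, {morph alpha i : x y / x - y}).
Hypotheses (alphaE : forall i d x, alpha i (m d x) = m d (alpha i x)).
Hypotheses (alpha_central : forall J : {set I}, (exists i, i \in J) ->
  exists2 t, (forall d, commute t d) &
    forall x, \sum_(i in J) alpha i x = m t x).

Local Notation Gam := (sdp (ffun_gmodule m I)).
Local Notation L := {ffun I -> option V}.

Let triv (g : sdp m) (x : unit) := x.
Let nolabel : L := [ffun=> None].

Fact diagB : {morph (fun x => [ffun i => alpha i x]) : x y / x - y}.
Proof. by move=> x y; apply/ffunP=> i; rewrite !ffunE alphaB. Qed.
Fact diagE d x :
  [ffun i => alpha i (m d x)] = ffun_gmodule m I d [ffun i => alpha i x].
Proof. by apply/ffunP=> i; rewrite !ffunE alphaE. Qed.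
Definition diag_hom := sdp_hom diagB diagE.

Fact sumB : {morph (fun x : {ffun I -> V} => \sum_i x i) : x y / x - y}.
Proof.
by move=> x y; rewrite -sumrB; apply: eq_bigr => i _; rewrite !ffunE.
Qed.
Fact sumE d (x : {ffun I -> V}) :
  \sum_i ffun_gmodule m I d x i = m d (\sum_i x i).
Proof.
rewrite (big_morph _ (gactD m d) (gact0 m d)).
by apply: eq_bigr => i _; rewrite ffunE.
Qed.
Definition sum_hom := sdp_hom sumB sumE.

Fact partB (J : {set I}) :
  {morph (fun x : V => \sum_(i in J) alpha i x) : x y / x - y}.
Proof.
by move=> x y; rewrite -sumrB; apply: eq_bigr => i _; rewrite alphaB.
Qed.
Fact partE (J : {set I}) d x :
  \sum_(i in J) alpha i (m d x) = m d (\sum_(i in J) alpha i x).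
Proof.
rewrite (big_morph _ (gactD m d) (gact0 m d)).
by apply: eq_bigr => i _; rewrite alphaE.
Qed.
Definition part_hom J := sdp_hom (partB J) (partE J).

Lemma sum_kill_diag S g : sum_hom (kill S (diag_hom g)) = part_hom (~: S) g.
Proof.
congr (_, _) => /=; rewrite [RHS]big_mkcond; apply: eq_bigr => i _.
by rewrite !ffunE inE /=; case: (i \in S) => //=; rewrite ffunE.
Qed.

Variables (q : nat) (z : chain (sdp m) q).
Hypothesis dz : differential z = 0.

Definition cube S : hchain L Gam q.+1 :=
  vmap (fun=> Some nolabel) (fun=> kill S \o diag_hom) (of_bar tt z).

Definition collapse (c : hchain L Gam q.+1) : chain (sdp m) q :=
  to_bar (vmap (fun=> Some tt) (fun=> sum_hom) c).

Lemma forget_nolabel i : forget i nolabel = Some nolabel.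
Proof. by congr Some; apply/ffunP=> j; rewrite !ffunE; case: eqP. Qed.

Lemma cross_cube i s S :
  collapse (cross (i :: s) (cube S)) =
  collapse (cross s (cube (i |: S))) - collapse (cross s (cube S)).
Proof.
rewrite /collapse /=.
have -> : kill_map i (cube S) = cube (i |: S).
  rewrite /kill_map /cube vmap_comp; apply: eq_vmap => [_|_ _ g] /=.
    exact: forget_nolabel.
  congr (_, _); apply/ffunP=> j; rewrite !ffunE /= ?ffunE !inE.
  by case: eqP.
have -> : forget_map i (cube S) = cube S.
  rewrite /forget_map /cube vmap_comp; apply: eq_vmap => [_|_ _ g] //=.
  exact: forget_nolabel.
by rewrite !raddfB.
Qed.

Lemma collapse_cube S : collapse (cube S) = chain_map (part_hom (~: S)) z.
Proof.
rewrite /collapse /cube vmap_comp -[in RHS](of_barK tt z) -(to_bar_vmap _ id).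
congr to_bar; apply: eq_vmap => [[] //|_ _ g]; exact: sum_kill_diag.
Qed.

Lemma part_hom_bound (J : {set I}) : (exists i, i \in J) ->
  is_bound (chain_map (part_hom J) z - z).
Proof.
move=> /alpha_central[t tC tE].
apply: (@chain_map_inner _ _ ((0, t) : sdp m)) => // -[x d].
rewrite !sdpME /=; congr (_, _).
  by rewrite tE gact0 oppr0 gact0 addr0 add0r.
by rewrite tC mulgK.
Qed.

Variable rho : {multiplicative sdp m -> sdp m}.
Hypothesis rhoE : forall g, rho g = (0, g.2).

Lemma cross_cube_bound (s : seq I) (S : {set I}) : uniq s ->
  ((exists2 j, j \notin s & j \notin S) ->
     is_bound (collapse (cross s (cube S)) - (if s is [::] then z else 0))) /\
  ((forall j, (j \in S) = (j \notin s)) ->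
     is_bound (collapse (cross s (cube S)) -
       (chain_map rho z - (if s is [::] then 0 else z)))).
Proof.
elim: s S => [|i s IH] S.
  split=> [[j _ jS]|SE].
    by rewrite collapse_cube; apply: part_hom_bound; exists j; rewrite inE.
  rewrite collapse_cube subr0 (eq_chain_map (f' := rho)) ?subrr //.
    exact: is_bound0.
  move=> g; rewrite rhoE; congr (_, _); apply: big1 => j.
  by rewrite inE SE.
move=> /= /andP[si us]; have [IHa IHb] := IH S us.
have [IHa' IHb'] := IH (i |: S) us.
rewrite -/(cross (i :: s) _) cross_cube; split=> [[j]|SE].
  rewrite inE negb_or => /andP[neji sj] jS; rewrite subr0.
  have ba := IHa (ex_intro2 _ _ j sj jS).
  have ba' := IHa' (ex_intro2 _ _ j sj _).
  have := is_boundB (ba' _) ba; rewrite opprB addrA subrK; apply.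
  by rewrite !inE negb_or neji.
have iS : i \notin S by rewrite SE inE eqxx.
have ba := IHa (ex_intro2 _ _ i si iS).
have bb : is_bound (collapse (cross s (cube (i |: S))) -
       (chain_map rho z - (if s is [::] then 0 else z))).
  apply: IHb' => j; rewrite !inE SE inE negb_or.
  by have [->|//] := eqVneq j i; rewrite si.
have := is_boundB bb ba; congr is_bound.
rewrite [- (collapse _ - _)]opprD addrACA -opprD; congr (_ - _).
by case: (s) => [|? ?]; rewrite ?oppr0 ?addr0.
Qed.

Lemma null_equiv_cube S : q = 0 \/ null (@lact _ _ m I) (hd (cube S)).
Proof.
have [q0|nz] := hd_of_bar dz; first by left.
right; rewrite hd_vmap; move: nz; apply: null_vmap => g x /=.
exists (kill S (diag_hom g)); last first.
  by move=> a; have /= -> := @gmulfM _ _ diag_hom g a; exact: kill_is_mul.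
by congr Some; apply/ffunP=> j; rewrite !ffunE.
Qed.

Theorem retraction_homotopic : (q < #|I|)%N ->
  is_bound (z - chain_map rho z).
Proof.
move=> ltq.
have [||||b nb _] := @cross_boundary _ _ m I (enum I) q (cube finset.set0).
- exact: enum_uniq.
- by rewrite -cardE.
- exact: null_equiv_cube.
- by move=> j; rewrite mem_enum.
have bA : is_bound (collapse (cross (enum I) (cube finset.set0))).
  exists (to_bar (vmap (fun=> Some tt) (fun=> sum_hom) b)).
  apply/eqP; rewrite -subr_eq0 -to_bar_hd hd_vmap -!raddfB; apply/eqP.
  apply: (@to_bar_null _ _ triv); move: nb; apply: null_vmap => g n.
  by exists (sum_hom g) => // a; exact: (@gmulfM _ _ sum_hom).
have [_ /(_ _)] := cross_cube_bound finset.set0 (enum_uniq I).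
case eI: (enum I) => [|i s].
  by move: ltq; rewrite cardE eI.
rewrite -eI => bB.
rewrite -opprB -sub0r; apply: is_boundB; first exact: is_bound0.
set x := collapse _ in bA bB; rewrite -[X in is_bound X](subKr x).
by apply: is_boundB => //; apply: bB => j; rewrite mem_enum inE.
Qed.

End Contraction.

(** * Block triangular groups *)

Lemma homology_map_bij (G H : groupType) (i : {multiplicative H -> G})
    (p : {multiplicative G -> H}) q :
  cancel i p ->
  (forall z : chain G q, differential z = 0 ->
     is_bound (z - chain_map i (chain_map p z))) ->
  bijective (@homology_map _ _ i q).
Proof.
move=> ipK bz; exists (@homology_map _ _ p q); elim/quotW=> z.
  apply: (etrans (congr1 (@homology_map _ _ p q) (homology_map_pi i z))).
  apply: (etrans (homology_map_pi p (Defs.cycle_map i z))).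
  congr (\pi_(homology _ q) _); apply: val_inj => /=.
  by rewrite chain_map_comp chain_map_id.
apply: (etrans (congr1 (@homology_map _ _ i q) (homology_map_pi p z))).
apply: (etrans (homology_map_pi i (Defs.cycle_map p z))).
apply/esym/eqP; rewrite -Quotient.idealrBE.
have [|b zb] := bz (val z); first exact/eqP/(valP z).
by apply/asboolP; exists b; rewrite -zb raddfB.
Qed.

Lemma mulg_bij_inv (G H : groupType) (f : {multiplicative G -> H}) :
  bijective f -> exists g : {multiplicative H -> G}, cancel f g /\ cancel g f.
Proof.
case=> g fK gK.
by exists (HB.pack_for {multiplicative H -> G} g
  (isMultiplicative.Build _ _ g (can2_gmulfM fK gK))).
Qed.

Lemma inj_surj_bij (T U : Type) (f : T -> U) :
  injective f -> (forall y, exists x, f x = y) -> bijective f.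
Proof.
move=> fI fS; pose g y := projT1 (cid (fS y)).
have gK : cancel g f by move=> y; exact: (projT2 (cid (fS y))).
by exists g => // x; apply: fI.
Qed.

Lemma infinite_avoid (T : eqType) (A : set T) (s : seq T) :
  infinite_set A -> exists2 x, A x & x \notin s.
Proof.
move=> Ainf; apply: contrapT => noA; apply: Ainf.
apply: (@sub_finite_set _ _ [set` s]); last exact: finite_seq.
move=> x Ax /=; apply: contrapT => /negP xs; apply: noA; by exists x.
Qed.

Lemma subset_sums_neq0 (V : zmodType) (A : set V) k : infinite_set A ->
  exists a : nat -> V, (forall i, (i < k)%N -> A (a i)) /\
    forall b : nat -> bool, (exists2 i, (i < k)%N & b i) ->
      \sum_(i < k | b i) a i != 0.
Proof.
move=> Ainf; elim: k => [|k [a [Aa a0]]].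
  by exists (fun=> 0); split=> // b [].
have [x Ax xs] := infinite_avoid
  [seq - \sum_(i < k | B i) a i | B : {ffun 'I_k -> bool}] Ainf.
exists (fun i => if i == k then x else a i); split=> [i|b [i ltik bi]].
  by rewrite ltnS leq_eqVlt; case: eqP => [_|_ /= /Aa].
rewrite big_mkcond big_ord_recr /= eqxx -big_mkcond /=.
rewrite (eq_bigr (fun i : 'I_k => a i)); last first.
  by move=> j _; rewrite ltn_eqF.
case: ifP => bk.
  apply: contraNneq xs => e; apply/mapP; exists [ffun i : 'I_k => b i].
    by rewrite mem_enum.
  rewrite (eq_bigl (fun i : 'I_k => b i)); last by move=> j; rewrite ffunE.
  by apply/eqP; rewrite -addr_eq0 addrC e.
rewrite addr0; apply: a0; exists i => //.
move: ltik; rewrite ltnS leq_eqVlt => /orP[/eqP ei|//].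
by rewrite -ei bi in bk.
Qed.

Lemma centre_scalemxAr (F : nzRingType) n p k a
    (A : 'M[F]_(n, p)) (B : 'M[F]_(p, k)) :
  centre F a -> A *m (a *: B) = a *: (A *m B).
Proof.
move=> ca; apply/matrixP=> i j; rewrite !mxE mulr_sumr; apply: eq_bigr => l _.
by rewrite !mxE !mulrA ca.
Qed.

Definition subzmod (V : zmodType) (S : zmodClosed V) := {x : V | x \in S}.

HB.instance Definition _ V S := SubChoice.on (@subzmod V S).
HB.instance Definition _ V S := [SubChoice_isSubZmodule of @subzmod V S by <:].

Lemma GL_invmx1 (F : nzRingType) n : GL_invmx (1%g : GL F n) = 1%:M.
Proof. exact: (congr1 val (invg1 (GL F n))). Qed.

Lemma GL_invmxM (F : nzRingType) n (g h : GL F n) :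
  GL_invmx (g * h)%g = GL_invmx h *m GL_invmx g.
Proof. exact: (congr1 val (invgM g h)). Qed.

(* (g1, g2) acts on M by x |-> g1 x g2^-1, and (x, (g1, g2)) stands for the
   block matrix [[1, x], [0, 1]] [[g1, 0], [0, g2]] = [[g1, x g2], [0, g2]]. *)
Section BlockModule.
Variables (F : nzRingType) (n m : nat).
Variables (G1 : groupClosed (GL F n)) (G2 : groupClosed (GL F m)).
Variable M : set 'M[F]_(n, m).
Hypotheses (subspM : centre_subspace M).
Hypotheses (G1M : mulGM G1 M = M) (MG2 : mulMG G2 M = M).

Definition mx_pred : {pred 'M[F]_(n, m)} := fun x => `[< M x >].

Fact mx_pred_closed : zmod_closed mx_pred.
Proof.
case: subspM => M0 MD MZ; split=> [|x y]; first exact/asboolP.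
move=> /asboolP Mx /asboolP My; apply/asboolP/MD => //.
by rewrite -scaleN1r; apply: MZ => // b; exact/commr_sym/commrN1.
Qed.

Definition mx_closed : zmodClosed 'M[F]_(n, m) :=
  HB.pack mx_pred (GRing.isZmodClosed.Build _ mx_pred mx_pred_closed).

Local Notation V := (subzmod mx_closed).
Local Notation D := (subgroup G1 * subgroup G2)%type.

Lemma mxVP (x : V) : M (val x).
Proof. exact/asboolP/(valP x). Qed.

Fact block_act_subproof (d : D) (x : V) :
  val (val d.1) *m val x *m GL_invmx (val d.2) \in mx_closed.
Proof.
apply/asboolP; rewrite -MG2; exists (val (val d.1) *m val x).
  rewrite -G1M; exists (val d.1); first exact: (valP d.1).
  by exists (val x) => //; exact: mxVP.
by exists (val (d.2^-1)%g) => //; exact: (valP (d.2^-1)%g).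
Qed.

Definition block_act (d : D) (x : V) : V :=
  exist (fun y => y \in mx_closed) _ (block_act_subproof d x).

Lemma val_block_act d x :
  val (block_act d x) = val (val d.1) *m val x *m GL_invmx (val d.2).
Proof. by []. Qed.

Fact block_actB d : {morph block_act d : x y / x - y}.
Proof. by move=> x y; apply: val_inj; rewrite /= mulmxBr mulmxBl. Qed.
Fact block_act1 : block_act 1%g =1 id.
Proof.
move=> x; apply: val_inj; rewrite val_block_act.
rewrite (_ : GL_invmx _ = 1%:M); last exact: GL_invmx1.
by rewrite mulmx1 [val (val _)]/= mul1mx.
Qed.
Fact block_actM d e x : block_act (d * e)%g x = block_act d (block_act e x).
Proof.
apply: val_inj; rewrite !val_block_act.
rewrite (_ : GL_invmx (val (d * e)%g.2) =
  GL_invmx (val e.2) *m GL_invmx (val d.2)).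
  by rewrite !mulmxA.
exact: GL_invmxM.
Qed.

Definition block_gmodule := GModule block_actB block_act1 block_actM.

Local Notation S := (sdp block_gmodule).

Definition sdp_mx (g : S) : 'M[F]_(n + m) :=
  block_mx (val (val g.2.1)) (val g.1 *m val (val g.2.2)) 0 (val (val g.2.2)).

Fact sdp_mx_invertible g : sdp_mx g \in @invertible_mx F (n + m).
Proof.
apply/asboolP; exists (block_mx (GL_invmx (val g.2.1))
  (- (GL_invmx (val g.2.1) *m val g.1)) 0 (GL_invmx (val g.2.2))).
rewrite !mulmx_block !mulmx0 !mul0mx !addr0 !add0r !GL_mulmxV !GL_mulVmx.
rewrite mulNmx mulmxN !mulmxA GL_mulmxV -!mulmxA GL_mulmxV mul1mx mulmx1.
by rewrite addrC subrr subrr -scalar_mx_block.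
Qed.

Definition sdp_GL (g : S) : GL F (n + m) :=
  exist (fun A => A \in @invertible_mx F (n + m)) _ (sdp_mx_invertible g).

Fact sdp_GL_block g : sdp_GL g \in block_group subspM G1M MG2.
Proof.
apply/asboolP; exists (val g.2.1), (val g.2.2), (val g.1 *m val (val g.2.2)).
split; rewrite ?(valP g.2.1) ?(valP g.2.2) //.
rewrite -MG2; exists (val g.1); first exact: mxVP.
by exists (val g.2.2) => //; exact: (valP g.2.2).
Qed.

Definition sdp_block g : subgroup (block_group subspM G1M MG2) :=
  exist (fun A => A \in block_group subspM G1M MG2) _ (sdp_GL_block g).

Fact sdp_block_is_mul : {morph sdp_block : g h / (g * h)%g}.
Proof.
move=> g h; apply/val_inj/val_inj; rewrite /= /sdp_mx mulmx_block /=.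
rewrite !mulmx0 !mul0mx !addr0 !add0r; congr block_mx.
rewrite mulmxDl addrC !mulmxA -(mulmxA (_ *m _) (GL_invmx _)) GL_mulVmx.
by rewrite mulmx1.
Qed.

HB.instance Definition _ :=
  isMultiplicative.Build _ _ sdp_block sdp_block_is_mul.

Lemma sdp_block_bij : bijective sdp_block.
Proof.
apply: inj_surj_bij => [[x [g1 g2]] [y [h1 h2]]|g].
  move=> /(congr1 (val \o val)) /= /eq_block_mx[/= e1 ex _ e2].
  have {}e1 : g1 = h1 by do 2!apply: val_inj.
  have {}e2 : g2 = h2 by do 2!apply: val_inj.
  subst h1 h2; congr (_, _); apply: val_inj => /=.
  have := congr1 (mulmx^~ (GL_invmx (val g2))) ex.
  by rewrite -!mulmxA GL_mulmxV !mulmx1.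
have /asboolP[g1 [g2 [x [g1G g2G Mx eg]]]] := valP g.
have Vx : x *m GL_invmx g2 \in mx_closed.
  apply/asboolP; rewrite -MG2; exists x => //; exists (g2^-1)%g => //.
  by rewrite /= gpredV.
exists (exist (fun A => A \in mx_closed) _ Vx,
  (exist (fun A => A \in G1) g1 g1G, exist (fun A => A \in G2) g2 g2G)).
apply/val_inj/val_inj; rewrite /= /sdp_mx /= eg; congr block_mx.
by rewrite -mulmxA GL_mulVmx mulmx1.
Qed.

End BlockModule.

Section ScalarAction.
Variable F : unitRingType.
Hypothesis skewF : forall x : F, x != 0 -> x \is a GRing.unit.

Lemma centre_sum (I : Type) (r : seq I) (P : pred I) (a : I -> F) :
  (forall i, centre F (a i)) -> centre F (\sum_(i <- r | P i) a i).
Proof.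
move=> ca b; rewrite /GRing.comm mulr_suml mulr_sumr.
by apply: eq_bigr => i _; exact: ca.
Qed.

Lemma scalar_GL n (a : F) : a != 0 -> exists g : GL F n, val g = a%:M.
Proof.
move=> /skewF ua; suff aG : a%:M \in @invertible_mx F n.
  by exists (exist (fun A => A \in @invertible_mx F n) _ aG).
by apply/asboolP; exists a^-1%:M; rewrite -!scalar_mxM mulrV // mulVr.
Qed.

Lemma scalar_centre_comm n k a (A : 'M[F]_(n, k)) :
  centre F a -> A *m a%:M = a *: A.
Proof.
by move=> ca; rewrite -[a%:M]mulmx1 mul_scalar_mx centre_scalemxAr ?mulmx1.
Qed.

End ScalarAction.

Section Dilation.
Variable F : unitRingType.
Hypothesis skewF : forall x : F, x != 0 -> x \is a GRing.unit.
Variables (n m : nat) (G1 : groupClosed (GL F n)) (G2 : groupClosed (GL F m)).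
Variable M : set 'M[F]_(n, m).
Hypotheses (subspM : centre_subspace M).
Hypotheses (G1M : mulGM G1 M = M) (MG2 : mulMG G2 M = M).
Local Notation V := (subzmod (mx_closed subspM)).
Local Notation act := (block_gmodule subspM G1M MG2).

Fact dilate_subproof a (ca : centre F a) (x : V) :
  a *: val x \in mx_closed subspM.
Proof. by have [_ _ MZ] := subspM; apply/asboolP/MZ => //; exact: mxVP. Qed.

Definition dilate a (ca : centre F a) (x : V) : V :=
  exist (fun y => y \in mx_closed subspM) _ (dilate_subproof ca x).

Lemma dilateB a (ca : centre F a) : {morph dilate ca : x y / x - y}.
Proof. by move=> x y; apply: val_inj; rewrite /= scalerBr. Qed.

Lemma dilateE a (ca : centre F a) d x :
  dilate ca (act d x) = act d (dilate ca x).
Proof.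
by apply: val_inj; rewrite /= centre_scalemxAr // scalemxAl.
Qed.

Lemma dilate_central a (ca : centre F a) : a != 0 ->
  central_scalars F n `<=` [set` G1] \/ central_scalars F m `<=` [set` G2] ->
  exists2 t, (forall d, commute t d) & forall x, dilate ca x = act t x.
Proof.
move=> a0 [sG|sG].
  have [g ga] := scalar_GL skewF n a0.
  have gG : g \in G1 by apply: sG; exists a.
  exists (exist (fun A => A \in G1) g gG, 1%g) => [[d1 d2]|x].
    congr (_, _); last by rewrite mul1g mulg1.
    by do 2!apply: val_inj; rewrite /= ga scalar_centre_comm // mul_scalar_mx.
  apply: val_inj; rewrite val_block_act [val _]/= ga mul_scalar_mx.
  rewrite (_ : GL_invmx _ = 1%:M) ?mulmx1 //; exact: GL_invmx1.
have [g ga] := scalar_GL skewF m a0.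
have gG : g \in G2 by apply: sG; exists a.
pose t2 : subgroup G2 := exist (fun A => A \in G2) g gG.
exists (1%g, t2^-1)%g => [[d1 d2]|x].
  congr (_, _); first by rewrite mul1g mulg1.
  apply/commute_sym/commuteV/val_inj/val_inj.
  by rewrite /= ga scalar_centre_comm // mul_scalar_mx.
apply: val_inj; rewrite val_block_act.
rewrite (_ : GL_invmx _ = val g); last exact: (congr1 val (invgK g)).
by rewrite ga scalar_centre_comm // [val (val _)]/= mul1mx.
Qed.

End Dilation.

Theorem theorem4p11 (F : unitRingType)
    (skewF : forall x : F, x != 0 -> x \is a GRing.unit)
    (centre_inf : infinite_set (centre F))
    (n m : nat) (n_gt0 : (0 < n)%N) (m_gt0 : (0 < m)%N)
    (G1 : groupClosed (GL F n)) (G2 : groupClosed (GL F m))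
    (scalars : central_scalars F n `<=` [set` G1] \/
               central_scalars F m `<=` [set` G2])
    (M : set 'M[F]_(n, m)) (subspM : centre_subspace M)
    (G1M : mulGM G1 M = M) (MG2 : mulMG G2 M = M) (q : nat) :
  bijective (@homology_map _ _ (block_embedding subspM G1M MG2) q).
Proof.
have [a [ca a0]] := subset_sums_neq0 q.+1 centre_inf.
pose act := block_gmodule subspM G1M MG2; pose V := subzmod (mx_closed subspM).
pose act0 := block_gmodule (centre_subspace0 F n m) (mulGM0 m G1) (mulMG0 n G2).
pose to : {multiplicative sdp act -> _} :=
  @sdp_block _ _ _ _ _ _ subspM G1M MG2.
pose to0 : {multiplicative sdp act0 -> subgroup (diag_group G1 G2)} :=
  @sdp_block _ _ _ _ _ _ (centre_subspace0 F n m) (mulGM0 m G1) (mulMG0 n G2).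
set i := block_embedding _ _ _.
have [from [toK fromK]] : exists from : {multiplicative _ -> sdp act},
    cancel to from /\ cancel from to := mulg_bij_inv (sdp_block_bij _ _ _).
have [from0 [_ from0K]] : exists from0 : {multiplicative _ -> sdp act0},
    cancel to0 from0 /\ cancel from0 to0 := mulg_bij_inv (sdp_block_bij _ _ _).
have zeroB (A B : zmodType) : {morph (fun _ : A => 0 : B) : x y / x - y}.
  by move=> x y; rewrite subrr.
have rhoE d (x : V) : 0 = act d 0 by rewrite gact0.
have rho0E d (x : V) : 0 = act0 d 0 by rewrite gact0.
pose rho : {multiplicative sdp act -> sdp act} := sdp_hom (zeroB _ _) rhoE.
pose rho0 : {multiplicative sdp act -> sdp act0} := sdp_hom (zeroB _ _) rho0E.
have i_to0 w d : i (to0 (w, d)) = to (0, d).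
  apply/val_inj/val_inj; rewrite /= /sdp_mx /= mul0mx.
  by have /= -> := mxVP w; rewrite mul0mx.
pose p : {multiplicative _ -> _} := to0 \o rho0 \o from.
have pE g : i (p (to g)) = to (rho g).
  exact: (etrans (congr1 (fun h => i (to0 (rho0 h))) (toK g)) (i_to0 0 g.2)).
apply: (@homology_map_bij _ _ i p) => [d|z dz].
  rewrite -[d]from0K; case: (from0 d) => w e.
  rewrite -/to0 i_to0 /= toK; congr (to0 (_, _)); apply: val_inj.
  by have /= -> := mxVP w.
pose al (j : 'I_q.+1) (x : V) : V := dilate (ca j (ltn_ord j)) x.
have alC (J : {set 'I_q.+1}) : (exists j, j \in J) ->
    exists2 t, (forall d, commute t d) &
      forall x, \sum_(j in J) al j x = act t x.
  move=> [j Jj].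
  have cs : centre F (\sum_(j in J) a j).
    by apply: centre_sum => k; exact/ca/ltn_ord.
  have J0 : \sum_(k in J) a k != 0.
    rewrite (eq_bigl (fun k : 'I_q.+1 => inord k \in J)); last first.
      by move=> k; rewrite inord_val.
    by apply: (a0 (fun k => inord k \in J)); exists j; rewrite ?inord_val.
  have [t tC tE] := dilate_central skewF subspM G1M MG2 cs J0 scalars.
  exists t => // x; rewrite -tE; apply: val_inj.
  by rewrite raddf_sum /= scaler_suml.
have alB j : {morph al j : x y / x - y} by exact: dilateB.
have alE j d x : al j (act d x) = act d (al j x) by exact: dilateE.
have dz' : differential (chain_map from z) = 0.
  by rewrite differential_chain_map dz raddf0.
have rhoE' g : rho g = (0, g.2) by [].
have ltq : (q < #|'I_q.+1|)%N by rewrite card_ord.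
have [b zb] := retraction_homotopic alB alE alC dz' rhoE' ltq.
exists (chain_map to b).
rewrite differential_chain_map -zb raddfB /= !chain_map_comp.
congr (_ - _); first by rewrite chain_map_id.
apply: eq_chain_map => g; rewrite -[g]fromK [LHS]pE /=.
by rewrite toK.
Qed.
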